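(* Let $\alpha\ge 2/d$ and $\alpha'\ge 12\exp(-100d)$ be given. Consider the Bernoulli model described in the context, suppose that $\sigma>0$ is known, that the noise assumption in the context is fulfilled and that $n\ge m\log(d)$. Then, for any $1\le k_0<k\le m$, there exists a confidence set $C_n\subset\mathcal A(a,k)$, computed from the data (and allowed to depend on $\sigma,a,U,k_0,k,\alpha,\alpha'$), which is honest at level $\alpha$ for the model $\mathcal A(a,k)\otimes\{\sigma\}$, i.e. for every $M_0\in\mathcal A(a,k)$ $$\mathbb P_{M_0,\sigma}(M_0\in C_n)\ge 1-\alpha,$$ and which adapts to the sub-model $\mathcal A(a,k_0)\otimes\{\sigma\}$ at level $\alpha'$, i.e. there is a constant $K=K(\alpha,\alpha',a,U,\sigma)>0$ such that $$\sup_{M_0\in\mathcal A(a,k_0)}\mathbb P_{M_0,\sigma}\left(|C_n|_F>K\sqrt{\frac{m_1m_2k_0d}{n}}\right)\le\alpha'\quad\text{and}\quad\sup_{M_0\in\mathcal A(a,k)}\mathbb P_{M_0,\sigma}\left(|C_n|_F>K\sqrt{\frac{m_1m_2kd}{n}}\right)\le\alpha' .$$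
   Context: Notation. $m=\min(m_1,m_2)$, $d=m_1+m_2$, $\|\cdot\|_F$ is the Frobenius norm, $|S|_F=\sup\{\|x-y\|_F:x,y\in S\}$, $\|A\|_\infty=\max_{i,j}|A_{ij}|$, $\mathcal A(a,k)=\{A\in\mathbb R^{m_1\times m_2}:\|A\|_\infty\le a,\ \mathrm{rank}(A)\le k\}$ with $a>0$; $\mathcal A(a,k)\otimes\{\sigma\}=\{(A,\sigma):A\in\mathcal A(a,k)\}$. Bernoulli model. Given $n\le m_1m_2$, put $p=n/(m_1m_2)$; the $B_{ij}$ are i.i.d. Bernoulli($p$), independent of the noise $(\epsilon_{ij})$, and one observes $B_{ij}$ and $Y_{ij}=B_{ij}(M_{ij}+\epsilon_{ij})$ for $1\le i\le m_1$, $1\le j\le m_2$. $\mathbb P_{M_0,\sigma}$ is the law of the data when the matrix is $M=M_0$ and the noise variance is $\sigma^2$. The minimax rate of estimation over $\mathcal A(a,k)$ in Frobenius norm in this model is of order $\sqrt{m_1m_2kd/n}$. Noise assumption: the $\epsilon_{ij}$ are independent, $\mathbb E\epsilon_{ij}=0$, $\mathbb E\epsilon_{ij}^2=\sigma^2$, and $\max_{i,j}|\epsilon_{ij}|\le U$ almost surely, where $U>0$ is a constant. *)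

(* Defs.v *)
From mathcomp Require Import all_boot all_order all_algebra.
From mathcomp Require Import all_classical all_reals all_analysis.

Set Implicit Arguments.
Unset Strict Implicit.
Unset Printing Implicit Defensive.

Import Order.TTheory GRing.Theory Num.Theory.
Import numFieldNormedType.Exports.

Local Open Scope classical_set_scope.
Local Open Scope ring_scope.

Section matrices.
Context {R : realType} {m1 m2 : nat}.

Definition frobenius (A : 'M[R]_(m1, m2)) : R :=
  Num.sqrt (\sum_i \sum_j A i j ^+ 2).

(* [|S|_F]; it is [-oo] for the empty set. *)
Definition frobenius_diam (S : set 'M[R]_(m1, m2)) : \bar R :=
  ereal_sup [set (frobenius (x - y))%:E | x in S & y in S].

(* The class [A(a, k)]; the library norm of a matrix is [max_ij |A i j|]. *)
Definition mx_class (a : R) (k : nat) : set 'M[R]_(m1, m2) :=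
  [set A | `|A| <= a /\ (\rank A <= k)%N].

End matrices.

Definition sigma_generated {d} {T I : Type} {T' : measurableType d}
    (X : I -> T -> T') : set (set T) :=
  <<s \bigcup_(i in [set: I]) preimage_set_system setT (X i) measurable >>.

Section independence.
Context {d : measure_display} {Omega : measurableType d} {R : realType}.
Variable P : probability Omega R.

Definition mutually_independent {d'} {T : measurableType d'} {I : finType}
    (X : I -> {RV P >-> T}) : Prop :=
  forall (J : {set I}) (E : I -> set T), (forall i, measurable (E i)) ->
    P (\bigcap_(i in [set` J]) (X i @^-1` E i)) =
    (\prod_(i in J) P (X i @^-1` E i))%E.

Definition independent_families {d1 d2} {T1 : measurableType d1}
    {T2 : measurableType d2} {I1 I2 : Type}
    (X : I1 -> {RV P >-> T1}) (Y : I2 -> {RV P >-> T2}) : Prop :=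
  forall E F : set Omega,
    sigma_generated X E -> sigma_generated Y F ->
    P (E `&` F) = (P E * P F)%E.

End independence.

Section bernoulli_model.
Context {R : realType} {m1 m2 : nat}.

(* An observation is the array of the pairs [(B_ij, Y_ij)]. *)
Definition data : Type := 'M[bool * R]_(m1, m2).

(* The product Borel sigma-algebra on the space of observations. *)
Definition data_measurable : set (set data) :=
  sigma_generated (fun (ij : 'I_m1 * 'I_m2) (x : data) => x ij.1 ij.2).

Section model.
Context {d : measure_display} {Omega : measurableType d}.
Variable P : probability Omega R.
Variable B : 'I_m1 * 'I_m2 -> {RV P >-> bool}.
Variable eps : 'I_m1 * 'I_m2 -> {RV P >-> R}.

Definition bernoulli_design (p : R) : Prop :=
  [/\ mutually_independent B,
      (forall ij, distribution P (B ij) =1 bernoulli_prob p) &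
      independent_families B eps].

Definition noise_assumption (sigma U : R) : Prop :=
  [/\ mutually_independent eps,
      (forall ij, 'E_P[eps ij]%E = 0%:E),
      (forall ij, 'E_P[(fun w => eps ij w ^+ 2)%R]%E = (sigma ^+ 2)%:E) &
      {ae P, forall w, forall ij, `|eps ij w| <= U}].

Definition observation (M : 'M[R]_(m1, m2)) (w : Omega) : data :=
  \matrix_(i, j) (B (i, j) w, (B (i, j) w)%:R * (M i j + eps (i, j) w)).

(* The law of the data when the unknown matrix is [M]. *)
Definition data_law (M : 'M[R]_(m1, m2)) (E : set data) : \bar R :=
  P (observation M @^-1` E).

Definition honest (Theta : set 'M[R]_(m1, m2)) (alpha : R)
    (C : data -> set 'M[R]_(m1, m2)) : Prop :=
  forall M0, Theta M0 -> ((1 - alpha)%:E <= data_law M0 [set x | C x M0])%E.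

Definition diam_controlled (Theta : set 'M[R]_(m1, m2)) (alpha' r : R)
    (C : data -> set 'M[R]_(m1, m2)) : Prop :=
  (ereal_sup [set data_law M0 [set x | r%:E < frobenius_diam (C x)]
             | M0 in Theta] <= alpha'%:E)%E.

End model.

(* A random subset of [Theta] that is a function of the data; measurability is
   what gives the coverage and diameter events a probability. *)
Definition confidence_set (Theta : set 'M[R]_(m1, m2))
    (C : data -> set 'M[R]_(m1, m2)) : Prop :=
  [/\ (forall x, C x `<=` Theta),
      (forall M0, Theta M0 -> data_measurable [set x | C x M0]) &
      (forall r : R, data_measurable [set x | (r%:E < frobenius_diam (C x))%E])].

End bernoulli_model.

Arguments data : clear implicits.

(* Main.v *)
Require Import Defs.
From mathcomp Require Import all_boot all_order all_algebra.
From mathcomp Require Import all_classical all_reals all_analysis.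
From mathcomp Require Import measurable_realfun.
From mathcomp Require Import ring lra.

(** The set is built from one statistic, computable because sigma is known:
    the residual of a matrix A,
      sum_ij B_ij ((Y_ij - A_ij)^2 - sigma^2),
    whose mean is p |A - M0|_F^2.  Let r_q^2 = m1 m2 q d / n be the squared
    minimax rate at rank q, so that p r_q^2 = q d.  The noise part of the
    residual has standard deviation of order sqrt n, and
    n <= m1 m2 <= d^2: it is at most of order d, hence never larger than the
    signal q d of a matrix at distance r_q.  Comparing the residual with a
    multiple tau of q d therefore separates the matrices within r_q of M0 from
    those further than J r_q, for some constant J.

    Fix a finite maximal r_q-separated subset N_q of A(a,q), for q = k0 and
    q = k ([separated_net]).  If some point of N_k0 passes the test at level
    tau k0 d, the confidence set is the ball of A(a,k) of radius J r_k0 about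
    the first such point; otherwise it is the ball of radius J r_k about the
    first point of N_k that passes at level tau k d, or the empty set if there
    is none.  Two facts about an arbitrary M0 bounded by a suffice:
    - a fixed matrix within r_q of M0 passes at level tau q d with probability
      at least 1 - beta ([near_accepted]);
    - with probability at least 1 - 2 beta, no point of N_q further than J r_q
      from M0 passes at that level ([far_rejected]).
    The second one, for q = k0 and q = k, makes every selected ball contain M0,
    and the first one, for q = k, makes the selection succeed; this is honesty.
    The diameter is always at most 2 J r_k; when M0 has rank at most k0, the
    first fact for q = k0 makes the small ball be selected.  Since K may depend
    on alpha and alpha', the constant error level
    beta = min(alpha, alpha') / 5 is good enough.

    The second fact is a union bound over N_q.  A Chernoff bound makes a fixed
    A pass with probability at most exp(O(q d) - c p |A - M0|_F^2)
    ([excess_risk_lower_tail]); as p r_q^2 = q d, at distance t r_q this is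
    at most exp(q d (O(1) - c t^2)).  On the other hand, for every eta > 0 at most
    exp(q d (eta t^2 + C_eta)) points of N_q lie within t r_q of M0
    ([low_rank_packing]), so that the sum over the shells of radius j r_q with
    j >= J is small ([net_tail_sum]).

    The packing bound comes from encoding a matrix of rank rho by two integer
    matrices: it factors as U V with norms of U and V under control
    ([low_rank_factor]), and the entries of both factors can be rounded to a
    grid so that the rounding errors add up as if they were independent and
    centred ([round_mx]).  The squared norm of the code is O(rho d t^2), and
    integer points are counted by an exponential moment
    ([count_int_points]). *)

Set Implicit Arguments.
Unset Strict Implicit.
Unset Printing Implicit Defensive.

Import Order.TTheory GRing.Theory Num.Theory.
Import numFieldNormedType.Exports.

Local Open Scope classical_set_scope.
Local Open Scope ring_scope.

(** * Squared Frobenius norm and low-rank factorization *)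

Definition frob2 {R : realType} {p q : nat} (A : 'M[R]_(p, q)) : R :=
  \sum_i \sum_j A i j ^+ 2.

Section frobenius_square.
Context {R : realType}.
Implicit Types p q : nat.

Lemma frob2_ge0 p q (A : 'M[R]_(p, q)) : 0 <= frob2 A.
Proof. by apply: sumr_ge0 => i _; apply: sumr_ge0 => j _; rewrite sqr_ge0. Qed.

Lemma frob2D p q (A B : 'M[R]_(p, q)) :
  frob2 (A + B) <= 2 * frob2 A + 2 * frob2 B.
Proof.
rewrite /frob2 !mulr_sumr -big_split /=; apply: ler_sum => i _.
rewrite !mulr_sumr -big_split /=; apply: ler_sum => j _; rewrite mxE.
by have := sqr_ge0 (A i j - B i j); lra.
Qed.

Lemma frob2N p q (A : 'M[R]_(p, q)) : frob2 (- A) = frob2 A.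
Proof. by do 2![apply: eq_bigr => ? _]; rewrite mxE sqrrN. Qed.

Lemma frob2B p q (A B : 'M[R]_(p, q)) :
  frob2 (A - B) <= 2 * frob2 A + 2 * frob2 B.
Proof. by rewrite -(frob2N B) frob2D. Qed.

Lemma frob2Z p q c (A : 'M[R]_(p, q)) : frob2 (c *: A) = c ^+ 2 * frob2 A.
Proof.
rewrite /frob2 mulr_sumr; apply: eq_bigr => i _.
by rewrite mulr_sumr; apply: eq_bigr => j _; rewrite mxE exprMn.
Qed.

Lemma frob2_tr p q (A : 'M[R]_(p, q)) : frob2 A^T = frob2 A.
Proof.
rewrite /frob2 exchange_big /=; apply: eq_bigr => i _; apply: eq_bigr => j _.
by rewrite mxE.
Qed.

Lemma frob2_rows p q (A : 'M[R]_(p, q)) : frob2 A = \sum_i frob2 (row i A).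
Proof.
apply: eq_bigr => i _; rewrite /frob2 big_ord1.
by apply: eq_bigr => j _; rewrite mxE.
Qed.

Lemma frob2_row_mx p q1 q2 (A : 'M[R]_(p, q1)) (B : 'M[R]_(p, q2)) :
  frob2 (row_mx A B) = frob2 A + frob2 B.
Proof.
rewrite /frob2 -big_split /=; apply: eq_bigr => i _.
rewrite big_split_ord /=; congr (_ + _); apply: eq_bigr => j _.
  by rewrite row_mxEl.
by rewrite row_mxEr.
Qed.

Lemma frob2_col_mx p1 p2 q (A : 'M[R]_(p1, q)) (B : 'M[R]_(p2, q)) :
  frob2 (col_mx A B) = frob2 A + frob2 B.
Proof. by rewrite -frob2_tr tr_col_mx frob2_row_mx !frob2_tr. Qed.

Lemma frob2_le_entries p q (A : 'M[R]_(p, q)) b :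
  (forall i j, `|A i j| <= b) -> frob2 A <= (p * q)%:R * b ^+ 2.
Proof.
move=> Ab; have b0 i j : A i j ^+ 2 <= b ^+ 2.
  by rewrite -real_normK ?num_real// lerXn2r ?nnegrE// (le_trans _ (Ab i j)).
apply: (@le_trans _ _ (\sum_(i < p) \sum_(j < q) b ^+ 2)).
  by apply: ler_sum => i _; apply: ler_sum.
by rewrite !sumr_const !card_ord -mulrnA mulnC mulr_natl.
Qed.

Lemma frob2_eq0 p q (A : 'M[R]_(p, q)) : frob2 A = 0 -> A = 0.
Proof.
move=> A0; apply/matrixP => i j; rewrite mxE; apply/eqP; rewrite -sqrf_eq0.
have /eqP := A0; rewrite psumr_eq0 => [|i' _]; last first.
  by apply: sumr_ge0 => ? _; rewrite sqr_ge0.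
move=> /allP /(_ i (mem_index_enum _)) /=.
rewrite psumr_eq0 => [|? _]; last by rewrite sqr_ge0.
by move=> /allP /(_ j (mem_index_enum _)).
Qed.

(** Each row of V is a unit vector u of the row space of what is left of the
    matrix; replacing F by F (1 - u^T u) lowers the rank by one and, by
    Pythagoras, splits its squared norm. *)
Lemma low_rank_factor rho p q (F : 'M[R]_(p, q)) : (\rank F <= rho)%N ->
  exists (U : 'M[R]_(p, rho)) (V : 'M[R]_(rho, q)),
    [/\ F = U *m V, frob2 U <= frob2 F & frob2 V <= rho%:R].
Proof.
elim: rho F => [|rho IH] F.
  rewrite leqn0 mxrank_eq0 => /eqP ->; exists 0, 0; split.
  - by rewrite mul0mx.
  - by rewrite /frob2 big1 ?frob2_ge0// => i _; rewrite big_ord0.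
  - by rewrite /frob2 big_ord0.
move=> rF; have [->|F0] := eqVneq F 0.
  exists 0, 0; split; first by rewrite mul0mx.
    by rewrite /frob2 big1 ?frob2_ge0// => i _; rewrite big1 // => j _; rewrite mxE expr0n.
  by rewrite /frob2 big1 ?ler0n// => i _; rewrite big1// => j _; rewrite mxE expr0n.
have [i Fi] : exists i, row i F != 0.
  apply/existsP; apply: contraNT F0; rewrite negb_exists => /forallP h.
  by apply/eqP/row_matrixP => i; rewrite row0; apply/eqP; have := h i; rewrite negbK.
pose c := Num.sqrt (frob2 (row i F)).
have c2 : c ^+ 2 = frob2 (row i F) by rewrite sqr_sqrtr ?frob2_ge0.
have c0 : c != 0.
  by apply: contraNneq Fi => c0; rewrite (@frob2_eq0 _ _ (row i F))// -c2 c0 expr0n.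
pose u := c^-1 *: row i F.
have u1 : frob2 u = 1 by rewrite /u frob2Z -c2 -exprMn mulVf// expr1n.
have uF : (u <= F)%MS by rewrite scalemx_sub// row_sub.
move: (u) u1 uF => {}u u1 uF.
have uu : u *m u^T = 1%:M.
  apply/matrixP => a b; rewrite !ord1 !mxE eqxx /= -u1 /frob2 big_ord1.
  by apply: eq_bigr => j _; rewrite [u^T _ _]mxE -expr2.
pose F' := F *m (1%:M - u^T *m u).
have F'E : F' = F - F *m u^T *m u by rewrite /F' mulmxBr mulmx1 mulmxA.
have rF' : (\rank F' <= rho)%N.
  have kerE := mxrank_mul_ker F (1%:M - u^T *m u).
  have : (u <= F :&: kermx (1%:M - u^T *m u))%MS.
    rewrite sub_capmx uF /=; apply/sub_kermxP.
    by rewrite mulmxBr mulmx1 mulmxA uu mul1mx subrr.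
  have rku : (0 < \rank u)%N.
    rewrite lt0n mxrank_eq0; apply/negP => /eqP u0.
    have : frob2 u = 0.
      by rewrite u0 /frob2 big1 // => a _; rewrite big1// => j _; rewrite mxE expr0n.
    by rewrite u1; apply/eqP; rewrite oner_eq0.
  move=> /mxrankS /(leq_trans rku).
  move=> r1; have : (\rank F' + 1 <= rho.+1)%N.
    by apply: leq_trans rF; rewrite -kerE leq_add2l.
  by rewrite addn1.
have pyth : frob2 F = frob2 (F *m u^T) + frob2 F'.
  rewrite /frob2 -big_split /=; apply: eq_bigr => a _; rewrite big_ord1.
  pose t := (F *m u^T) a ord0.
  have tE : t = \sum_j F a j * u ord0 j.
    by rewrite /t mxE; apply: eq_bigr => j _; rewrite mxE.
  have u1' : \sum_j u ord0 j ^+ 2 = 1 by rewrite -u1 /frob2 big_ord1.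
  rewrite -/t.
  have -> : \sum_j F a j ^+ 2 = t ^+ 2 +
      (\sum_j F a j ^+ 2 - 2 * t * (\sum_j F a j * u ord0 j) +
       t ^+ 2 * (\sum_j u ord0 j ^+ 2)).
    by rewrite -tE u1'; ring.
  congr (_ + _); rewrite !mulr_sumr -sumrB -big_split /=.
  apply: eq_bigr => j _.
    have -> : F' a j = F a j - t * u ord0 j.
      by rewrite F'E [LHS]mxE; rewrite [X in _ + X]mxE [X in _ - X]mxE big_ord1.
    ring.
have [U' [V' [FE' U'le V'le]]] := IH F' rF'.
have : exists (U : 'M[R]_(p, 1 + rho)) (V : 'M[R]_(1 + rho, q)),
    [/\ F = U *m V, frob2 U <= frob2 F & frob2 V <= (1 + rho)%:R].
  exists (row_mx (F *m u^T) U'), (col_mx u V'); split.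
  - by rewrite mul_row_col -FE' F'E addrC subrK.
  - by rewrite frob2_row_mx pyth lerD2l.
  - by rewrite frob2_col_mx u1 natrD lerD2l.
by [].
Qed.

(** * Rounding a factor to the integer grid *)

(** Rounding y up with probability equal to its fractional part would give an
    error term of mean zero and of variance at most 1/4, so one of the two
    roundings does at least as well as the average. *)
Lemma round_step q (x w : 'rV[R]_q) (y : R) : exists z : int,
  `|y - z%:~R| <= 1 /\
  frob2 (x + (y - z%:~R) *: w) <= frob2 x + frob2 w / 4.
Proof.
pose t := y - (Num.floor y)%:~R.
have t0 : 0 <= t by rewrite subr_ge0 floor_le.
have t1 : t <= 1 by rewrite lerBlDl -(intrD1) ltW// floorD1_gt.
have avg : (1 - t) * frob2 (x + t *: w) + t * frob2 (x + (t - 1) *: w) =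
    frob2 x + t * (1 - t) * frob2 w.
  rewrite /frob2 !big_ord1 !mulr_sumr -!big_split /=.
  by apply: eq_bigr => j _; rewrite !mxE; ring.
have tt : t * (1 - t) * frob2 w <= frob2 w / 4.
  rewrite [leRHS]mulrC ler_wpM2r ?frob2_ge0//.
  by have := sqr_ge0 (t - 2^-1); lra.
have [h|h] := leP (frob2 (x + t *: w)) (frob2 x + frob2 w / 4).
  by exists (Num.floor y); split=> [|//]; rewrite -/t ger0_norm.
exists (Num.floor y + 1); rewrite intrD opprD addrA -/t; split.
  by rewrite ler0_norm; lra.
rewrite leNgt; apply/negP => h'.
have : frob2 x + frob2 w / 4 < (1 - t) * frob2 (x + t *: w) + t * frob2 (x + (t - 1) *: w).
  have [t00|tn0] := eqVneq t 0; first by move: h; rewrite t00 subr0 mul1r mul0r addr0.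
  have tp : 0 < t by rewrite lt_def tn0.
  have : t * (frob2 x + frob2 w / 4) < t * frob2 (x + (t - 1) *: w) by rewrite ltr_pM2l.
  have : (1 - t) * (frob2 x + frob2 w / 4) <= (1 - t) * frob2 (x + t *: w).
    by rewrite ler_wpM2l ?subr_ge0// ltW.
  by lra.
by rewrite avg; lra.
Qed.

Lemma round_row rho q (y : 'I_rho -> R) (W : 'M[R]_(rho, q)) :
  exists z : 'I_rho -> int, (forall l, `|y l - (z l)%:~R| <= 1) /\
  frob2 (\sum_l (y l - (z l)%:~R) *: row l W) <= frob2 W / 4.
Proof.
rewrite frob2_rows mulr_suml.
have [z [z1 zW]] : exists z : 'I_rho -> int, (forall l, `|y l - (z l)%:~R| <= 1) /\
    frob2 (\sum_(l <- index_enum 'I_rho) (y l - (z l)%:~R) *: row l W) <=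
    \sum_(l <- index_enum 'I_rho) frob2 (row l W) / 4.
  elim: (index_enum _) (index_enum_uniq 'I_rho) => [_|i s IH /= /andP[i_s us]].
    exists (fun l => Num.floor (y l)); rewrite !big_nil; split => [l|].
      by rewrite ger0_norm ?subr_ge0 ?floor_le// lerBlDl -(intrD1) ltW// floorD1_gt.
    by rewrite /frob2 big1// => a _; rewrite big1// => b _; rewrite mxE expr0n.
  have [z [z1 zW]] := IH us.
  have [zi [zi1 ziW]] := round_step (\sum_(l <- s) (y l - (z l)%:~R) *: row l W)
     (row i W) (y i).
  exists (fun l => if l == i then zi else z l); split.
    by move=> l; case: eqP => [->|].
  rewrite !big_cons eqxx addrC.
  rewrite (eq_big_seq (fun l => (y l - (z l)%:~R) *: row l W)); last first.
    by move=> l ls /=; case: eqP => // li; rewrite -li ls in i_s.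
  by apply: (le_trans ziW); rewrite addrC lerD2l.
by exists z.
Qed.

(** The error carries the squared norm of W itself, with no factor rho: this
    is what makes the packing bound free of logarithms of the rank. *)
Lemma round_mx p rho q (X : 'M[R]_(p, rho)) (W : 'M[R]_(rho, q)) :
  exists Z : 'M[int]_(p, rho), (forall i l, `|X i l - (Z i l)%:~R| <= 1) /\
  frob2 ((X - map_mx intr Z) *m W) <= p%:R * frob2 W / 4.
Proof.
have /fin_all_exists[z zP] := fun i => round_row (X i) W.
exists (\matrix_(i, l) z i l); split.
  by move=> i l; rewrite mxE; case: (zP i).
rewrite frob2_rows; apply: (@le_trans _ _ (\sum_(i < p) (frob2 W / 4))); last first.
  by rewrite sumr_const card_ord -[leLHS]mulr_natl mulrA.
apply: ler_sum => i _; apply: le_trans (zP i).2.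
rewrite row_mul mulmx_sum_row.
rewrite [leLHS](_ : _ = frob2 (\sum_l (X i l - (z i l)%:~R) *: row l W))//; congr frob2.
by apply: eq_bigr => l _; rewrite !mxE.
Qed.

End frobenius_square.

(** * Packing numbers of bounded-rank matrices *)

Section counting.
Context {R : realType}.

Lemma geometric_le (x : R) n : 0 <= x -> x < 1 ->
  \sum_(k < n) x ^+ k <= (1 - x)^-1.
Proof.
move=> x0 x1; rewrite -[leRHS]mul1r ler_pdivlMr ?subr_gt0// mulrC.
have -> : (1 - x) * \sum_(k < n) x ^+ k = 1 - x ^+ n.
  by rewrite -[RHS]opprB subrX1 -mulNr opprB.
by rewrite lerBlDr lerDl exprn_ge0.
Qed.

(** Each code c weighs at most exp(theta (Q - sum_i |c_i|)), because
    |z| <= z^2 for an integer z; the sum of these weights over all integer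
    vectors is a power of a geometric series. *)
Lemma count_int_points (I : finType) (theta Q : R) (s : seq {ffun I -> int}) :
  0 < theta -> uniq s ->
  (forall c, c \in s -> \sum_i (c i)%:~R ^+ 2 <= Q) ->
  (size s)%:R <= expR (theta * Q) * (2 / (1 - expR (- theta))) ^+ #|I|.
Proof.
move=> th0 us sQ.
pose B := (\max_(c <- s) \max_i `|c i|)%N.
have cB c i : c \in s -> (`|c i| < B.+1)%N.
  move=> cs; rewrite ltnS; apply: leq_trans (leq_bigmax_seq _ cs isT).
  exact: (leq_bigmax i).
pose h (c : {ffun I -> int}) : {ffun I -> bool * 'I_B.+1} :=
  [ffun i => (c i < 0, inord `|c i|%N)].
have h_inj : {in s &, injective h}.
  move=> c c' cs c's /ffunP hh; apply/ffunP => i; move: (hh i); rewrite !ffunE.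
  move=> [sg] /(congr1 val) /=; rewrite !inordK ?cB// => ab.
  by rewrite [LHS]intEsign [RHS]intEsign sg ab.
pose x : R := expR (- theta).
have x0 : 0 < x by exact: expR_gt0.
have x1 : x < 1 by rewrite expR_lt1 oppr_lt0.
pose wt (f : {ffun I -> bool * 'I_B.+1}) : R := \prod_i x ^+ (f i).2.
have wt0 f : 0 <= wt f by apply: prodr_ge0 => i _; rewrite exprn_ge0 ?ltW.
have geo : \sum_(k < B.+1) x ^+ k <= (1 - x)^-1 := geometric_le _ (ltW x0) x1.
have tot : \sum_f wt f <= (2 / (1 - x)) ^+ #|I|.
  rewrite -(bigA_distr_bigA (fun (i : I) (bk : bool * 'I_B.+1) => x ^+ bk.2)).
  rewrite prodr_const /=.
  apply: lerXn2r; rewrite ?nnegrE.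
  - by apply: sumr_ge0 => bk _; rewrite exprn_ge0// ltW.
  - by rewrite divr_ge0// subr_ge0 ltW.
  - rewrite -(pair_bigA _ (fun (b : bool) (k : 'I_B.+1) => x ^+ k)) /=.
    by rewrite big_bool /= mulrDl !mul1r lerD.
apply: (@le_trans _ _ (expR (theta * Q) * \sum_(c <- s) wt (h c))).
  rewrite -sum1_size natr_sum mulr_sumr big_seq [leRHS]big_seq.
  apply: ler_sum => c cs; rewrite /wt prodrXr /x -expRM_natl -expRD.
  rewrite -[leLHS]expR0 ler_expR.
  have -> : (\sum_i (h c i).2)%N = (\sum_i `|c i|)%N.
    by apply: eq_bigr => i _; rewrite ffunE /= inordK ?cB.
  rewrite mulrN [_%:R * _]mulrC -mulrBr mulr_ge0 ?(ltW th0)// subr_ge0.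
  apply: le_trans (sQ c cs); rewrite natr_sum; apply: ler_sum => i _.
  have -> : (c i)%:~R ^+ 2 = ((`|c i| ^ 2)%N)%:R :> R.
    by rewrite natrX natr_absz intr_norm real_normK ?num_real.
  by rewrite ler_nat; case: `|c i|%N => // n; rewrite expnS expn1 leq_pmulr.
rewrite ler_wpM2l ?expR_ge0//; apply: le_trans tot.
rewrite -(big_map h xpredT) big_uniq ?map_inj_in_uniq// big_mkcond /=.
by apply: ler_sum => f _; case: ifP.
Qed.

(** With U V the factorization of F, V is rounded first, against U, and then U
    against the rounded V; the grid steps s1 and s2 balance the two errors.
    Rounding V with step s2 costs s2^2 q |U|_F^2 / 4 = r^2 / 16, and rounding U
    with step s1 costs s1^2 p (4 rho) / 4 = r^2 / 16. *)
Lemma low_rank_code p q rho (t r s1 s2 : R) (F : 'M[R]_(p, q)) :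
  (0 < p)%N -> (0 < q)%N -> (0 < rho)%N -> 1 <= t -> 0 < r ->
  0 < s1 -> s1 ^+ 2 = r ^+ 2 / (16 * p%:R * rho%:R) ->
  0 < s2 -> s2 ^+ 2 = 1 / (16 * t ^+ 2 * q%:R) ->
  (\rank F <= rho)%N -> frob2 F <= 4 * t ^+ 2 * r ^+ 2 ->
  exists (Z1 : 'M[int]_(p, rho)) (Z2 : 'M[int]_(rho, q)),
    [/\ frob2 (map_mx intr Z1 : 'M[R]_(p, rho)) <= 144 * t ^+ 2 * (p * rho)%:R,
        frob2 (map_mx intr Z2 : 'M[R]_(rho, q)) <= 144 * t ^+ 2 * (rho * q)%:R &
        frob2 (F - (s1 * s2) *: (map_mx intr Z1 *m map_mx intr Z2)) <= r ^+ 2 / 4].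
Proof.
move=> p0 q0 rho0 t1 r0 s10 s1E s20 s2E rF Fle.
have pR : 0 < p%:R :> R by rewrite ltr0n.
have qR : 0 < q%:R :> R by rewrite ltr0n.
have rhoR : 0 < rho%:R :> R by rewrite ltr0n.
have t0 : 0 < t by apply: lt_le_trans t1.
have t21 : 1 <= t ^+ 2 by rewrite expr_ge1// ltW.
have r20 : 0 < r ^+ 2 by rewrite exprn_gt0.
have s120 : 0 < s1 ^+ 2 by rewrite exprn_gt0.
have s220 : 0 < s2 ^+ 2 by rewrite exprn_gt0.
have [U [V [FE Ule Vle]]] := low_rank_factor rF.
have [Z2t [Z2t1 Z2te]] := round_mx (s2^-1 *: V^T) U^T.
pose Z2 := Z2t^T.
pose Z2R : 'M[R]_(rho, q) := map_mx intr Z2.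
have E2 : frob2 (U *m (V - s2 *: Z2R)) <= r ^+ 2 / 16.
  have -> : U *m (V - s2 *: Z2R) = s2 *: ((s2^-1 *: V^T - map_mx intr Z2t) *m U^T)^T.
    rewrite trmx_mul trmxK scalemxAr; congr (_ *m _).
    by apply/matrixP => i j; rewrite !mxE mulrBr mulrA divff ?gt_eqF// mul1r.
  rewrite frob2Z frob2_tr.
  apply: (@le_trans _ _ (s2 ^+ 2 * (q%:R * (4 * t ^+ 2 * r ^+ 2) / 4))).
    rewrite ler_wpM2l ?(ltW s220)//; apply: le_trans Z2te _.
    by rewrite frob2_tr ler_wpM2r ?invr_ge0// ler_wpM2l ?ler0n// (le_trans Ule).
  by rewrite s2E le_eqVlt; apply/orP; left; apply/eqP; field; rewrite !gt_eqF.
have Z2d : frob2 (V - s2 *: Z2R) <= rho%:R / 16.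
  apply: (@le_trans _ _ ((rho * q)%:R * s2 ^+ 2)).
    apply: frob2_le_entries => i j; rewrite !mxE.
    have := Z2t1 j i; rewrite !mxE => h.
    rewrite (_ : _ - _ = s2 * (s2^-1 * V i j - (Z2t j i)%:~R)); last first.
      by rewrite mulrBr mulrA divff ?gt_eqF// mul1r.
    by rewrite normrM (gtr0_norm s20) ler_piMr// ltW.
  rewrite natrM s2E.
  rewrite [leLHS](_ : _ = rho%:R / 16 * (t ^+ 2)^-1); last by field; rewrite !gt_eqF.
  by rewrite ler_piMr ?divr_ge0 ?ler0n// invf_le1// exprn_gt0.
have Z2s : frob2 (s2 *: Z2R) <= 4 * rho%:R.
  rewrite (_ : s2 *: Z2R = V - (V - s2 *: Z2R)); last by rewrite opprB addrC subrK.
  by apply: le_trans (frob2B _ _) _; lra.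
have [Z1 [Z11 Z1e]] := round_mx (s1^-1 *: U) (s2 *: Z2R).
pose Z1R : 'M[R]_(p, rho) := map_mx intr Z1.
have E1 : frob2 ((U - s1 *: Z1R) *m (s2 *: Z2R)) <= r ^+ 2 / 16.
  have -> : U - s1 *: Z1R = s1 *: (s1^-1 *: U - Z1R).
    by rewrite scalerBr scalerA divff ?gt_eqF// scale1r.
  rewrite -scalemxAl frob2Z; apply: (@le_trans _ _ (s1 ^+ 2 * (p%:R * (4 * rho%:R) / 4))).
    rewrite ler_wpM2l ?(ltW s120)//; apply: le_trans Z1e _.
    by rewrite ler_wpM2r ?invr_ge0// ler_wpM2l ?ler0n.
  by rewrite s1E le_eqVlt; apply/orP; left; apply/eqP; field; rewrite !gt_eqF.
have Z1d : frob2 (U - s1 *: Z1R) <= r ^+ 2 / 16.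
  apply: (@le_trans _ _ ((p * rho)%:R * s1 ^+ 2)).
    apply: frob2_le_entries => i j; rewrite !mxE.
    have := Z11 i j; rewrite !mxE => h.
    rewrite (_ : _ - _ = s1 * (s1^-1 * U i j - (Z1 i j)%:~R)); last first.
      by rewrite mulrBr mulrA divff ?gt_eqF// mul1r.
    by rewrite normrM (gtr0_norm s10) ler_piMr// ltW.
  by rewrite natrM s1E le_eqVlt; apply/orP; left; apply/eqP; field; rewrite !gt_eqF.
have Z1s : frob2 (s1 *: Z1R) <= 9 * t ^+ 2 * r ^+ 2.
  rewrite (_ : s1 *: Z1R = U - (U - s1 *: Z1R)); last by rewrite opprB addrC subrK.
  apply: le_trans (frob2B _ _) _.
  have : r ^+ 2 <= t ^+ 2 * r ^+ 2 by rewrite ler_peMl// ltW.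
  by move: (le_trans Ule Fle); lra.
exists Z1, Z2; split.
- rewrite -(ler_pM2l s120) -frob2Z; apply: le_trans Z1s _.
  by rewrite s1E natrM le_eqVlt; apply/orP; left; apply/eqP; field; rewrite !gt_eqF.
- rewrite -(ler_pM2l s220) -frob2Z; apply: le_trans Z2s _.
  rewrite s2E natrM [leRHS](_ : _ = 9 * rho%:R); last by field; rewrite !gt_eqF.
  by move: rhoR; lra.
rewrite (_ : _ - _ = U *m (V - s2 *: Z2R) + (U - s1 *: Z1R) *m (s2 *: Z2R)); last first.
  rewrite mulmxBr mulmxBl -FE addrA subrK -scalemxAl -!scalemxAr scalerA.
  by [].
by apply: le_trans (frob2D _ _) _; lra.
Qed.

(** Relative to one of the points, the others have rank at most 2 kappa and
    norm at most 2 t r.  Two points with the same code lie within r of each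
    other, so separated points have distinct codes. *)
Lemma low_rank_packing p q kappa (theta t r : R) (M : 'M[R]_(p, q))
    (s : seq 'M[R]_(p, q)) :
  (0 < p)%N -> (0 < q)%N -> (0 < kappa)%N -> 0 < theta -> 1 <= t -> 0 < r ->
  uniq s -> {in s &, forall A A', A != A' -> r ^+ 2 < frob2 (A - A')} ->
  (forall A, A \in s -> (\rank A <= kappa)%N /\ frob2 (A - M) <= t ^+ 2 * r ^+ 2) ->
  (size s)%:R <= (expR (144 * theta * t ^+ 2) * (2 / (1 - expR (- theta))))
                   ^+ (2 * kappa * (p + q)).
Proof.
move=> p0 q0 k0 th0 t1 r0 us ssep sM.
have G0 : 0 < 2 / (1 - expR (- theta)) :> R.
  by rewrite divr_gt0// subr_gt0 expR_lt1 oppr_lt0.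
case: s us ssep sM => [|A1 s'] us ssep sM.
  by rewrite exprn_ge0// mulr_ge0 ?expR_ge0// ltW.
set s := A1 :: s' in us ssep sM *.
set rho := (2 * kappa)%N.
have rho0 : (0 < rho)%N by rewrite muln_gt0.
pose s1 : R := Num.sqrt (r ^+ 2 / (16 * p%:R * rho%:R)).
pose s2 : R := Num.sqrt (1 / (16 * t ^+ 2 * q%:R)).
have t0 : 0 < t by apply: lt_le_trans t1.
have a1 : 0 < r ^+ 2 / (16 * p%:R * rho%:R).
  by rewrite divr_gt0 ?mulr_gt0 ?exprn_gt0 ?ltr0n.
have a2 : 0 < 1 / (16 * t ^+ 2 * q%:R).
  by rewrite divr_gt0 ?mulr_gt0 ?exprn_gt0 ?ltr0n.
have s10 : 0 < s1 by rewrite sqrtr_gt0.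
have s20 : 0 < s2 by rewrite sqrtr_gt0.
have A1s : A1 \in s by rewrite mem_head.
have : forall A, exists Z : 'M[int]_(p, rho) * 'M[int]_(rho, q), A \in s ->
    [/\ frob2 (map_mx intr Z.1 : 'M[R]_(p, rho)) <= 144 * t ^+ 2 * (p * rho)%:R,
        frob2 (map_mx intr Z.2 : 'M[R]_(rho, q)) <= 144 * t ^+ 2 * (rho * q)%:R &
        frob2 (A - A1 - (s1 * s2) *: (map_mx intr Z.1 *m map_mx intr Z.2)) <= r ^+ 2 / 4].
  move=> A; have [As|] := boolP (A \in s); last by exists (0, 0).
  have rk : (\rank (A - A1)%R <= rho)%N.
    apply: leq_trans (mxrank_add _ _) _; rewrite mxrank_opp /rho mul2n -addnn.
    by rewrite leq_add ?(sM _ As).1 ?(sM _ A1s).1.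
  have fr : frob2 (A - A1) <= 4 * t ^+ 2 * r ^+ 2.
    rewrite (_ : A - A1 = (A - M) - (A1 - M)); last by rewrite opprB addrA subrK.
    apply: le_trans (frob2B _ _) _.
    by move: (sM _ As).2 (sM _ A1s).2; lra.
  have [Z1 [Z2 ZP]] := low_rank_code p0 q0 rho0 t1 r0 s10 (sqr_sqrtr (ltW a1))
    s20 (sqr_sqrtr (ltW a2)) rk fr.
  by exists (Z1, Z2).
move=> /choice[code codeP].
pose I := ('I_p * 'I_rho + 'I_rho * 'I_q)%type.
pose fcode A : {ffun I -> int} := [ffun i => match i with
  | inl ij => (code A).1 ij.1 ij.2 | inr ij => (code A).2 ij.1 ij.2 end].
have codeE A A' : fcode A = fcode A' -> code A = code A'.
  move=> /ffunP h; rewrite [LHS]surjective_pairing [RHS]surjective_pairing.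
  by congr pair; apply/matrixP => i j; [have := h (inl (i, j))|have := h (inr (i, j))];
    rewrite !ffunE.
have inj : {in s &, injective fcode}.
  move=> A A' As A's /codeE cE; apply/eqP; apply/negPn/negP => /(ssep _ _ As A's).
  apply/negP; rewrite -leNgt.
  have [_ _ h] := codeP A As; have [_ _ h'] := codeP A' A's.
  rewrite cE in h.
  set C := _ *: _ in h h'.
  rewrite (_ : A - A' = (A - A1 - C) - (A' - A1 - C)); last first.
    by rewrite opprB addrA subrK opprB addrA subrK.
  by apply: le_trans (frob2B _ _) _; lra.
have cnt := @count_int_points I theta (144 * t ^+ 2 * (rho * (p + q))%:R) (map fcode s) th0.
have cI : #|{: I}| = (rho * (p + q))%N.
  by rewrite card_sum !card_prod !card_ord mulnDr [(p * rho)%N]mulnC.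
rewrite size_map cI in cnt; apply: le_trans (cnt _ _) _.
- by rewrite map_inj_in_uniq.
- move=> c /mapP[A As ->]; rewrite big_sumType /=.
  have [h1 h2 _] := codeP A As.
  rewrite mulnDr natrD mulrDr lerD//.
    rewrite [(rho * p)%N]mulnC; apply: le_trans h1.
    rewrite /frob2 pair_bigA /=; apply: ler_sum => i _.
    by rewrite ffunE mxE.
  apply: le_trans h2.
  rewrite /frob2 pair_bigA /=; apply: ler_sum => i _.
  by rewrite ffunE mxE.
rewrite [leRHS]exprMn -expRM_natl ler_wpM2r ?exprn_ge0 ?(ltW G0)//.
by rewrite ler_expR le_eqVlt; apply/orP; left; apply/eqP; ring.
Qed.

End counting.

(** * Nets of A(a,k) *)

Section nets.
Context {R : realType}.

Lemma entry_le_norm p q (A : 'M[R]_(p, q)) i j : `|A i j| <= `|A|.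
Proof.
have -> : `|A| = mx_norm A by [].
by rewrite mx_normrE (le_bigmax _ (fun ij => `|A ij.1 ij.2|) (i, j)).
Qed.

Definition frob_separated p q (r : R) (s : seq 'M[R]_(p, q)) :=
  uniq s /\ {in s &, forall A A', A != A' -> r ^+ 2 < frob2 (A - A')}.

(** The sizes of the separated families are bounded by [low_rank_packing], so
    adding uncovered points one at a time has to stop. *)
Lemma separated_net p q kappa (a r : R) :
  (0 < p)%N -> (0 < q)%N -> (0 < kappa)%N -> 0 < a -> 0 < r ->
  exists s : seq 'M[R]_(p, q), [/\ frob_separated r s,
    forall A, A \in s -> mx_class a kappa A &
    forall M, mx_class a kappa M -> exists2 A, A \in s & frob2 (M - A) <= r ^+ 2].
Proof.
move=> p0 q0 k0 a0 r0.
pose good (s : seq 'M[R]_(p, q)) :=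
  frob_separated r s /\ (forall A, A \in s -> mx_class a kappa A).
pose covers (s : seq 'M[R]_(p, q)) :=
  forall M, mx_class a kappa M -> exists2 A, A \in s & frob2 (M - A) <= r ^+ 2.
have [L bnd] : exists L : nat, forall s, good s -> (size s <= L)%N.
  pose t : R := 1 + (p * q)%:R * a / r.
  have t1 : 1 <= t by rewrite lerDl divr_ge0 ?mulr_ge0 ?ler0n ?ltW.
  pose b : R := (expR (144 * 1 * t ^+ 2) * (2 / (1 - expR (- 1))))
                   ^+ (2 * kappa * (p + q)).
  exists (Num.truncn b) => s [[us ss] sc].
  have := @low_rank_packing R p q kappa 1 t r 0 s p0 q0 k0 ltr01 t1 r0 us ss.
  rewrite -/b => h; rewrite truncn_ge_nat.
    apply: h => A /sc[Aa rA]; split => //; rewrite subr0.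
    apply: le_trans (frob2_le_entries (b := a) _) _ => [i j|].
      by apply: le_trans Aa; exact: entry_le_norm.
    rewrite -exprMn /t mulrDl mul1r divfK ?gt_eqF//.
    have pq1 : 1 <= (p * q)%:R :> R by rewrite ler1n muln_gt0 p0.
    have : (p * q)%:R * a ^+ 2 <= ((p * q)%:R * a) ^+ 2.
      rewrite exprMn ler_wpM2r ?sqr_ge0// expr2 ler_peMl// ler0n//.
    move=> /le_trans; apply; rewrite lerXn2r ?nnegrE ?addr_ge0 ?mulr_ge0 ?ler0n ?ltW//.
    by rewrite ltrDr.
  apply: exprn_ge0; apply: mulr_ge0; first exact: expR_ge0.
  by rewrite divr_ge0// subr_ge0 ltW// expR_lt1 oppr_lt0.
have grow n : exists s, good s /\ (covers s \/ size s = n).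
  elim: n => [|n [s [gs [cs|sn]]]].
  - by exists [::]; split; [split=> //|right].
  - by exists s; split=> //; left.
  have [cs|ncs] := pselect (covers s); first by exists s; split=> //; left.
  have [M [Mc Ms]] : exists M, mx_class a kappa M /\
      forall A, A \in s -> r ^+ 2 < frob2 (M - A).
    apply: contrapT => nex; apply: ncs => M Mc; apply: contrapT => nA.
    apply: nex; exists M; split=> // A As; rewrite ltNge; apply/negP => le.
    by apply: nA; exists A.
  have Mns : M \notin s.
    apply/negP => /Ms; rewrite subrr -(scale0r (0 : 'M[R]_(p, q))) frob2Z expr0n mul0r.
    by rewrite ltNge sqr_ge0.
  have [[us ss] sc] := gs.
  exists (M :: s); split; last by right; rewrite /= sn.
  split; first split; first by rewrite /= Mns.
    move=> A A'; rewrite !inE => /orP[/eqP->|As] /orP[/eqP->|A's].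
    - by rewrite eqxx.
    - by move=> _; apply: Ms.
    - by move=> _; rewrite -frob2N opprB; apply: Ms.
    - exact: ss.
  by move=> A; rewrite inE => /orP[/eqP->//|]; exact: sc.
have [s [gs [cs|sn]]] := grow L.+1; last by have := bnd s gs; rewrite sn ltnn.
by exists s; case: gs.
Qed.

(** In the shell j r <= |A - M|_F < (j+1) r, with j >= 1, the terms are at most
    exp(N (b - c j^2)) where N = kappa (p + q), and the number of points is at
    most exp(N (c j^2 / 2 + C)) by the packing bound with
    288 theta (j + 1)^2 <= c j^2 / 2.  For j >= J large the product is at most
    exp(- (J + j)), whose sum over j is at most 2 exp(- J) <= beta. *)
Lemma net_tail_sum (b c beta : R) : 0 < c -> 0 < beta ->
  exists2 J : nat, (0 < J)%N & forall p q kappa (r : R) (M : 'M[R]_(p, q)) s,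
    (0 < p)%N -> (0 < q)%N -> (0 < kappa)%N -> 0 < r -> frob_separated r s ->
    (forall A, A \in s -> (\rank A <= kappa)%N) ->
    \sum_(A <- s | J%:R ^+ 2 * r ^+ 2 < frob2 (A - M))
      expR ((kappa * (p + q))%:R * (b - c * (frob2 (A - M) / r ^+ 2))) <= beta.
Proof.
move=> c0 beta0.
pose theta : R := c / (16 * 144).
have th0 : 0 < theta by rewrite divr_gt0// mulr_gt0 ?ltr0n.
pose G : R := 2 / (1 - expR (- theta)).
have G0 : 0 < G by rewrite divr_gt0// subr_gt0 expR_lt1 oppr_lt0.
pose C : R := 2 * ln G + b.
have pos1 : 0 <= 4 * `|C| / c by rewrite divr_ge0 ?mulr_ge0// ltW.
have pos2 : 0 < 8 / c by rewrite divr_gt0.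
have pos3 : 0 < 2 / beta by rewrite divr_gt0.
pose J := (Num.truncn (8 / c + 4 * `|C| / c + 2 / beta)).+1.
have J8 : 8 / c + 4 * `|C| / c + 2 / beta < J%:R.
  have pos : 0 <= 8 / c + 4 * `|C| / c + 2 / beta.
    by move: pos1 pos2 pos3; lra.
  by have /andP[_] := truncn_itv pos.
have cJ8 : 8 <= c * J%:R by rewrite mulrC -ler_pdivrMr//; move: J8; lra.
have cJC : 4 * C <= c * J%:R.
  apply: (@le_trans _ _ (4 * `|C|)); first by rewrite ler_pM2l// ler_norm.
  by rewrite mulrC mulrC (mulrC c) -ler_pdivrMr//; move: J8; lra.
have betaJ : 2 / (1 + J%:R) <= beta.
  rewrite ler_pdivrMr ?ltr_pwDl// mulrC -ler_pdivrMr//.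
  by move: J8; lra.
have J1 : 1 <= J%:R :> R by rewrite ler1n.
exists J => // p q kappa r M s p0 q0 k0 r0 [us ss] sk.
have r20 : 0 < r ^+ 2 by rewrite exprn_gt0.
pose N : R := (kappa * (p + q))%:R.
have N1 : 1 <= N by rewrite ler1n muln_gt0 k0 addn_gt0 p0.
pose T (A : 'M[R]_(p, q)) : R := Num.sqrt (frob2 (A - M) / r ^+ 2).
have T0 A : 0 <= T A by exact: sqrtr_ge0.
have T2 A : T A ^+ 2 = frob2 (A - M) / r ^+ 2.
  by rewrite sqr_sqrtr// divr_ge0 ?frob2_ge0// ltW.
pose j A := Num.truncn (T A).
pose L := \max_(A <- s) j A.
have jL A : A \in s -> (j A < L.+1)%N.
  by move=> As; rewrite ltnS; exact: (leq_bigmax_seq _ As isT).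
pose jo A : 'I_L.+1 := inord (j A).
rewrite (partition_big jo xpredT)//=.
pose x : R := expR (- 1).
have x12 : x <= 2^-1.
  rewrite /x expRN lef_pV2 ?posrE ?expR_gt0//.
  by have := expR_ge1Dx (1 : R); lra.
have x0 : 0 < x by exact: expR_gt0.
apply: (@le_trans _ _ (\sum_(i < L.+1) x ^+ J * x ^+ i)); last first.
  rewrite -mulr_sumr; apply: (@le_trans _ _ (x ^+ J * (1 - x)^-1)).
    by rewrite ler_wpM2l ?exprn_ge0 ?(ltW x0)// geometric_le ?ltW//; move: x12; lra.
  apply: le_trans betaJ; rewrite [leRHS]mulrC ler_pM//.
  - by rewrite exprn_ge0// ltW.
  - by rewrite invr_ge0; move: x12; lra.
  - rewrite /x -expRM_natl mulrN1 expRN lef_pV2 ?posrE ?expR_gt0//.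
    exact: expR_ge1Dx.
  - by rewrite -[leRHS]invrK lef_pV2 ?posrE ?invr_gt0//; move: x12; lra.
apply: ler_sum => i _.
have [iJ|Ji] := ltnP i J.
  rewrite big_seq_cond big1 ?mulr_ge0 ?exprn_ge0 ?(ltW x0)// => A /and3P[As far].
  move=> /eqP/(congr1 val) /=; rewrite /jo inordK ?jL//.
  move=> jA; exfalso; move: iJ; rewrite -jA ltnNge => /negP; apply.
  rewrite /j truncn_ge_nat//.
  rewrite -(@ler_pXn2r _ 2) ?nnegrE// T2 ler_pdivlMr//; exact: ltW.
pose sh := [seq A <- s | j A == i].
have shP A : A \in sh -> [/\ A \in s, i%:R <= T A & T A <= i.+1%:R].
  rewrite mem_filter => /andP[/eqP jA As]; split => //.
    by have /andP[+ _] := truncn_itv (T0 A); rewrite -/(j A) jA.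
  by have /andP[_ +] := truncn_itv (T0 A); rewrite -/(j A) jA => /ltW.
have iR : J%:R <= i%:R :> R by rewrite ler_nat.
apply: (@le_trans _ _ (\sum_(A <- sh) expR (N * (b - c * i%:R ^+ 2)))).
  rewrite /sh big_filter big_seq_cond [leRHS]big_seq_cond.
  rewrite [leLHS]big_mkcond [leRHS]big_mkcond /=; apply: ler_sum => A _.
  have [As|]/= := boolP (A \in s); last by [].
  case: ifP => [/andP[_ /eqP joA]|_]; last by case: ifP => // _; exact: expR_ge0.
  have jA : j A = i.
    by rewrite -(congr1 val joA) /jo /= inordK// jL.
  rewrite jA eqxx ler_expR ler_pM2l ?(lt_le_trans _ N1)// lerD2l lerN2 ler_pM2l//.
  rewrite -T2 lerXn2r ?nnegrE//.
  by have [|_ + _] := shP A; first by rewrite mem_filter jA eqxx.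
rewrite big_const_seq count_predT iter_addr_0 -[leLHS]mulr_natl.
have cnt : (size sh)%:R <= expR (N * (2 * (144 * theta * i.+1%:R ^+ 2 + ln G))).
  have i1 : 1 <= i.+1%:R :> R by rewrite ler1n.
  have ush : uniq sh by rewrite filter_uniq.
  have := @low_rank_packing R p q kappa theta i.+1%:R r M sh p0 q0 k0 th0 i1 r0 ush.
  rewrite -/G => h; apply: (le_trans (h _ _)).
  - by move=> A A' /shP[As _ _] /shP[A's _ _]; exact: ss.
  - move=> A /shP[As _ Ti]; split; first exact: sk.
    by rewrite -ler_pdivrMr// -T2 lerXn2r ?nnegrE.
  rewrite -{1}(lnK G0) -expRD -expRM_natl ler_expR /N.
  by rewrite !natrM le_eqVlt; apply/orP; left; apply/eqP; ring.
apply: (@le_trans _ _ (expR (N * (2 * (144 * theta * i.+1%:R ^+ 2 + ln G))) *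
    expR (N * (b - c * i%:R ^+ 2)))).
  by rewrite ler_wpM2r ?expR_ge0.
rewrite -exprD /x -expRM_natl -expRD ler_expR mulrN1 -mulrDr.
have bracket : 2 * (144 * theta * i.+1%:R ^+ 2 + ln G) + (b - c * i%:R ^+ 2) <= - (J + i)%:R.
  have i21 : (i.+1%:R : R) ^+ 2 <= 4 * i%:R ^+ 2.
    have -> : (4 * i%:R ^+ 2 : R) = (2 * i%:R) ^+ 2 by ring.
    by rewrite lerXn2r ?nnegrE ?mulr_ge0// -natr1; lra.
  have e1 : 2 * (144 * theta) * i.+1%:R ^+ 2 <= c / 2 * i%:R ^+ 2.
    apply: (@le_trans _ _ (2 * (144 * theta) * (4 * i%:R ^+ 2))).
      by rewrite ler_pM2l// !mulr_gt0// ltr0n.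
    by rewrite /theta le_eqVlt; apply/orP; left; apply/eqP; field.
  have i0 : 0 < i%:R :> R by lra.
  have e2 : c * J%:R <= c * i%:R ^+ 2.
    rewrite ler_pM2l// expr2; apply: (le_trans iR).
    by rewrite ler_peMl//; lra.
  have e3 : 8 * i%:R <= c * i%:R ^+ 2.
    rewrite expr2 mulrA ler_pM2r//; apply: (le_trans cJ8).
    by rewrite ler_pM2l.
  have -> : 2 * (144 * theta * i.+1%:R ^+ 2 + ln G) = 2 * (144 * theta) * i.+1%:R ^+ 2 + 2 * ln G.
    by ring.
  rewrite natrD; move: cJC e1 e2 e3; rewrite /C; lra.
apply: (@le_trans _ _ (N * - (J + i)%:R)); first by rewrite ler_pM2l// (lt_le_trans _ N1).
by rewrite mulrN lerN2 ler_peMl// ler0n.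
Qed.

End nets.

(** * Product formula for independent variables *)

Section weighted.
Context {d : measure_display} {Omega : measurableType d} {R : realType}.
Variable P : probability Omega R.
Import HBNNSimple.

Lemma weighted_nnsfun (h : Omega -> R) (X : Omega -> R) (phi : {nnsfun R >-> R}) :
  measurable_fun setT h -> (forall w, 0 <= h w) -> measurable_fun setT X ->
  (\int[P]_w (h w * phi (X w))%:E =
   \sum_(y \in range phi) y%:E * \int[P]_w (h w * \1_(phi @^-1` [set y]) (X w))%:E)%E.
Proof.
move=> mh h0 mX.
have mI y : measurable_fun setT (fun w => h w * \1_(phi @^-1` [set y]) (X w)).
  apply: measurable_funM => //; apply: (measurableT_comp _ mX).
  by apply: measurable_indic.
have phi0 y : (range phi) y -> 0 <= y by move=> [x _ <-]; exact: fun_ge0.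
transitivity (\int[P]_w (\sum_(y \in range phi)
    (Num.max y 0)%:E * (h w * \1_(phi @^-1` [set y]) (X w))%:E))%E.
  apply: eq_integral => w _; rewrite {1}(fimfunE phi) mulr_fsumr.
  rewrite -fsumEFin//; apply: eq_fsbigr => y; rewrite inE => /phi0 y0.
  by rewrite max_l// -EFinM mulrCA.
rewrite ge0_integral_fsum//=; first last.
- by move=> y w _; rewrite -EFinM lee_fin !mulr_ge0 ?le_max ?lexx ?orbT.
- move=> y; apply: measurable_funeM; exact/measurable_EFinP.
apply: eq_fsbigr => y; rewrite inE => /phi0 y0; rewrite max_l//.
rewrite ge0_integralZl_EFin//.
- by move=> w _; rewrite lee_fin mulr_ge0.
- exact/measurable_EFinP.
Qed.

(** Two weights that have the same integral against every event of X have the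
    same integral against every nonnegative function of X, by approximation
    with simple functions. *)
Lemma weighted_integral (h1 h2 : Omega -> R) (X : Omega -> R) (g : R -> R) :
  measurable_fun setT h1 -> (forall w, 0 <= h1 w) ->
  measurable_fun setT h2 -> (forall w, 0 <= h2 w) ->
  measurable_fun setT X -> measurable_fun setT g -> (forall x, 0 <= g x) ->
  (forall S, measurable S ->
    \int[P]_w (h1 w * \1_S (X w))%:E = \int[P]_w (h2 w * \1_S (X w))%:E)%E ->
  (\int[P]_w (h1 w * g (X w))%:E = \int[P]_w (h2 w * g (X w))%:E)%E.
Proof.
move=> mh1 h10 mh2 h20 mX mg g0 h12.
have mgE : measurable_fun setT (EFin \o g) by exact/measurable_EFinP.
pose phi := nnsfun_approx measurableT mgE.
have lim (h : Omega -> R) : measurable_fun setT h -> (forall w, 0 <= h w) ->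
    (\int[P]_w (h w * g (X w))%:E = limn (fun n => \int[P]_w (h w * phi n (X w))%:E))%E.
  move=> mh h0; rewrite -monotone_convergence//.
  - apply: eq_integral => w _; apply/esym/cvg_lim => //.
    rewrite EFinM; under eq_fun do rewrite EFinM.
    apply: cvgeZl => //.
    exact: (@cvg_nnsfun_approx _ _ _ _ measurableT _ mgE (fun x _ => g0 x) (X w) I).
  - move=> n; apply/measurable_EFinP/measurable_funM => //.
    exact: measurableT_comp.
  - by move=> n w _; rewrite lee_fin mulr_ge0.
  - move=> w _ a b ab; rewrite lee_fin ler_wpM2l//.
    by have /lefP := nd_nnsfun_approx measurableT mgE ab; exact.
rewrite lim// lim//; congr (limn _); apply/funext => n.
rewrite !weighted_nnsfun//; apply: eq_fsbigr => y _; congr (_ * _)%E.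
exact: h12.
Qed.

End weighted.

Section product_formula.
Context {d : measure_display} {Omega : measurableType d} {R : realType}.
Variables (P : probability Omega R) (I : finType) (e : I -> Omega -> R).
Variable H : set Omega.
Hypothesis me : forall i, measurable_fun setT (e i).
Hypothesis mH : measurable H.
Hypothesis indep : forall E : I -> set R, (forall i, measurable (E i)) ->
  (P (H `&` \bigcap_(i in [set: I]) (e i @^-1` E i)) =
   P H * \prod_i P (e i @^-1` E i))%E.

Let mpre i (E : set R) : measurable E -> measurable (e i @^-1` E).
Proof. by move=> mE; rewrite -[X in measurable X]setTI; exact: me. Qed.

Let integral_indic_comp i (E : set R) : measurable E ->
  (\int[P]_w (\1_E (e i w))%:E = (fine (P (e i @^-1` E)))%:E)%E.
Proof.
move=> mE; rewrite fineK ?fin_num_measure//; last exact: mpre.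
by rewrite -(setIT (e i @^-1` E)) -integral_indic//; exact: mpre.
Qed.

(** The hypothesis is the case where every g i is an indicator.  The functions
    are released from being indicators one index at a time: for the index i,
    [weighted_integral] compares the weight 1_H prod_(j != i) g j (e j) with a
    constant. *)
Lemma integral_prod_indep (g : I -> R -> R) (m : I -> R) :
  (forall i, measurable_fun setT (g i)) -> (forall i x, 0 <= g i x) ->
  (forall i, \int[P]_w (g i (e i w))%:E = (m i)%:E)%E ->
  (\int[P]_w (\1_H w * \prod_i g i (e i w))%:E = (fine (P H) * \prod_i m i)%:E)%E.
Proof.
move=> mg g0 gm.
suff [s [us]] : exists s : seq I, uniq s /\
    forall i, i \notin s -> exists2 E, measurable E & g i = \1_E.
  elim: s us g m mg g0 gm => [_ g m mg g0 gm /(_ _ erefl) indicg|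
      i s IH /= /andP[i_s us] g m mg g0 gm indicg].
    have /choice[E EP] : forall i, exists E, measurable E /\ g i = \1_E.
      by move=> i; have [E mE gE] := indicg i; exists E.
    have mE i : measurable (E i) by case: (EP i).
    have gE i : g i = \1_(E i) by case: (EP i).
    transitivity (\int[P]_w (\1_(H `&` \bigcap_(i in [set: I]) (e i @^-1` E i)) w)%:E)%E.
      apply: eq_integral => w _; congr EFin; rewrite indicI /=; congr (_ * _).
      have [all_in|] := pselect (forall i, E i (e i w)).
        rewrite big1 => [|i _]; last by rewrite gE indicE mem_set.
        by rewrite indicE mem_set// => i _ /=.
      move=> /existsNP[i nEi]; rewrite (bigD1 i)//= gE indicE memNset// mul0r.
      by rewrite indicE memNset// => /(_ i Logic.I).
    rewrite integral_indic//; last first.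
      apply: measurableI => //; apply: fin_bigcap_measurable => // i _; exact: mpre.
    rewrite setIT; apply: (etrans (indep mE)).
    rewrite EFinM fineK ?fin_num_measure//; congr (_ * _)%E.
    rewrite -prodEFin; apply: eq_bigr => i _; rewrite -gm gE.
    by rewrite integral_indic_comp// fineK ?fin_num_measure//; exact: mpre.
  pose C := fine (P H) * \prod_(j | j != i) m j.
  pose h w := \1_H w * \prod_(j | j != i) g j (e j w).
  have m0 j : 0 <= m j.
    by rewrite -lee_fin -gm; apply: integral_ge0 => w _; rewrite lee_fin.
  have C0 : 0 <= C by rewrite mulr_ge0 ?fine_ge0// prodr_ge0.
  have splitP (gg : I -> R -> R) w : \1_H w * \prod_j gg j (e j w) =
      (\1_H w * \prod_(j | j != i) gg j (e j w)) * gg i (e i w).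
    by rewrite (bigD1 i)//= mulrA mulrAC.
  under eq_integral do rewrite splitP -/(h _).
  rewrite (@weighted_integral _ _ _ P h (cst C) (e i) (g i)) => //.
  - under eq_integral do rewrite EFinM.
    rewrite ge0_integralZl_EFin//.
    + by rewrite gm -EFinM [in RHS](bigD1 i)//= /C -mulrA [m i * _]mulrC.
    + by move=> w _; rewrite lee_fin.
    + by apply/measurable_EFinP; exact: measurableT_comp.
  - apply: measurable_funM; first exact: measurable_indic.
    have -> : (fun w => \prod_(j | j != i) g j (e j w)) =
        (fun w => \prod_j (if j != i then g j (e j w) else 1)).
      by apply/funext => w; rewrite [LHS]big_mkcond.
    apply: measurable_prod => j _; case: (j != i); last exact: measurable_cst.
    exact: measurableT_comp.
  - by move=> w; rewrite mulr_ge0// prodr_ge0.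
  move=> S mS.
  pose g' j := if j == i then \1_S : R -> R else g j.
  pose m' j := if j == i then fine (P (e i @^-1` S)) else m j.
  have gm' j : (\int[P]_w (g' j (e j w))%:E = (m' j)%:E)%E.
    rewrite /g' /m'; case: eqP => [->|_]; last exact: gm.
    exact: integral_indic_comp.
  have mg' j : measurable_fun setT (g' j).
    by rewrite /g'; case: (j == i) => //; exact: measurable_indic.
  have g'0 j x : 0 <= g' j x by rewrite /g'; case: (j == i).
  have indicg' j : j \notin s -> exists2 E, measurable E & g' j = \1_E.
    move=> js; rewrite /g'; case: eqP => [_|ji]; first by exists S.
    by apply: indicg; rewrite inE negb_or js andbT; apply/eqP.
  transitivity (fine (P H) * \prod_j m' j)%:E.
    rewrite -(IH us g' m' mg' g'0 gm' indicg').
    apply: eq_integral => w _; rewrite splitP /h /g' eqxx; congr ((_ * _ * _)%:E).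
    by apply: eq_bigr => j /negPf ->.
  under eq_integral do rewrite EFinM.
  rewrite ge0_integralZl_EFin//; last first.
    by apply/measurable_EFinP; apply: (measurableT_comp _ (me i)); exact: measurable_indic.
  rewrite integral_indic_comp// -EFinM; congr EFin.
  rewrite (bigD1 i)//= {1}/m' eqxx /C -mulrA; congr (_ * _); rewrite mulrC.
  by congr (_ * _); apply: eq_bigr => j /negPf ji; rewrite /m' ji.
by exists (enum I); split; [exact: enum_uniq|move=> i; rewrite mem_enum].
Qed.

End product_formula.

(** * Chernoff bound for sums thinned by a Bernoulli design *)

Section thinned_sums.
Context {d : measure_display} {Omega : measurableType d} {R : realType}.
Variables (P : probability Omega R) (I : finType).
Variables (B : I -> {RV P >-> bool}) (eps : I -> {RV P >-> R}) (p : R).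
Hypothesis p01 : 0 <= p <= 1.
Hypothesis B_indep : mutually_independent B.
Hypothesis B_distr : forall i, distribution P (B i) =1 bernoulli_prob p.
Hypothesis B_eps : independent_families B eps.
Hypothesis eps_indep : mutually_independent eps.

Lemma sigma_generated_bigcap d' (T' : measurableType d') (X : I -> {RV P >-> T'})
    (E : I -> set T') : (forall i, measurable (E i)) ->
  sigma_generated X (\bigcap_(i in [set: I]) (X i @^-1` E i)).
Proof.
move=> mE.
pose G := \bigcup_(i in [set: I]) preimage_set_system setT (X i) measurable.
have : @measurable _ (g_sigma_algebraType G) (\bigcap_(i in [set: I]) (X i @^-1` E i)).
  apply: fin_bigcap_measurable => // i _.
  apply: sub_sigma_algebra; exists i => //; exists (E i) => //.
  by rewrite setTI.
exact.
Qed.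

Lemma indep_setT d' (T' : measurableType d') (X : I -> {RV P >-> T'})
    (E : I -> set T') : mutually_independent X -> (forall i, measurable (E i)) ->
  (P (\bigcap_(i in [set: I]) (X i @^-1` E i)) = \prod_i P (X i @^-1` E i))%E.
Proof.
move=> iX mE; have := iX [set: I]%SET E mE.
rewrite (_ : [set` [set: I]%SET] = [set: I])//.
  by move=> ->; apply: eq_bigl => i; rewrite finset.in_setT.
by apply/seteqP; split => i //= _; rewrite finset.in_setT.
Qed.

Let design (b : {ffun I -> bool}) : set Omega :=
  \bigcap_(i in [set: I]) (B i @^-1` [set b i]).

Let mdesign b : measurable (design b).
Proof.
apply: fin_bigcap_measurable => // i _.
by rewrite -[X in measurable X]setTI; exact: measurable_funP.
Qed.

Let P_design b : fine (P (design b)) = \prod_i (if b i then p else 1 - p).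
Proof.
rewrite /design indep_setT//.
have -> : (\prod_i P (B i @^-1` [set b i]) = \prod_i (if b i then p else 1 - p)%:E)%E.
  apply: eq_bigr => i _; have := B_distr i [set b i].
  rewrite /distribution/= /pushforward => ->.
  rewrite bernoulli_probE// !diracE.
  case: (b i).
    by rewrite mem_set//= memNset//= mule1 mule0 adde0.
  by rewrite memNset//= mem_set//= mule1 mule0 add0e.
by rewrite prodEFin.
Qed.

(** Conditionally on the design the exponential moment factors; averaging over
    the 2^|I| designs turns each factor m_i into 1 - p + p m_i, which is at
    most exp(p c_i). *)
Lemma mgf_thinned (g : I -> R -> R) (c : I -> R) :
  (forall i, measurable_fun setT (g i)) ->
  (forall i, \int[P]_w (expR (g i (eps i w)))%:E <= (1 + c i)%:E)%E ->
  (\int[P]_w (expR (\sum_i (B i w)%:R * g i (eps i w)))%:E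
     <= (expR (p * \sum_i c i))%:E)%E.
Proof.
move=> mg gc.
pose f (b : {ffun I -> bool}) i (x : R) : R := if b i then expR (g i x) else 1.
pose m i : R := fine (\int[P]_w (expR (g i (eps i w)))%:E).
have int0 i : (0 <= \int[P]_w (expR (g i (eps i w)))%:E)%E.
  by apply: integral_ge0 => w _; rewrite lee_fin expR_ge0.
have mE i : (\int[P]_w (expR (g i (eps i w)))%:E = (m i)%:E)%E.
  by rewrite fineK// ge0_fin_numE// (le_lt_trans (gc i))// ltry.
have mc i : m i <= 1 + c i by rewrite -lee_fin -mE.
have mge0 i : 0 <= m i by rewrite -lee_fin -mE.
have mf b i : measurable_fun setT (f b i).
  rewrite /f; case: (b i); last exact: measurable_cst.
  exact: measurableT_comp.
have f0 b i x : 0 <= f b i x by rewrite /f; case: (b i); rewrite ?expR_ge0.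
have mBf b : measurable_fun setT (fun w => \1_(design b) w * \prod_i f b i (eps i w)).
  apply: measurable_funM; first exact: measurable_indic.
  by apply: measurable_prod => i _; exact: measurableT_comp.
have mgfE w : expR (\sum_i (B i w)%:R * g i (eps i w)) =
    \sum_b \1_(design b) w * \prod_i f b i (eps i w).
  pose bw : {ffun I -> bool} := [ffun i => B i w].
  rewrite (bigD1 bw)//= [X in _ + X]big1 ?addr0.
    rewrite indicE mem_set ?mul1r; last by move=> i _ /=; rewrite ffunE.
    rewrite expR_sum; apply: eq_bigr => i _; rewrite /f ffunE.
    by case: (B i w); rewrite ?mul1r// mul0r expR0.
  move=> b bbw; rewrite indicE memNset ?mul0r// => Db.
  move/eqP: bbw; apply; apply/ffunP => i; rewrite ffunE.
  by have := Db i Logic.I.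
have intb b : (\int[P]_w (\1_(design b) w * \prod_i f b i (eps i w))%:E =
    (\prod_i (if b i then p * m i else 1 - p))%:E)%E.
  rewrite (@integral_prod_indep _ _ _ P I eps (design b) _ _ _ (f b)
    (fun i => if b i then m i else 1))//.
  - rewrite P_design -big_split /=; congr EFin; apply: eq_bigr => i _.
    by case: (b i); rewrite ?mulr1.
  - move=> E mE'; rewrite B_eps.
    + by rewrite (indep_setT eps_indep mE').
    + by apply: sigma_generated_bigcap => i.
    + exact: sigma_generated_bigcap.
  - move=> i; rewrite /f; case: (b i); first exact: mE.
    by rewrite integral_cst// mul1e -[RHS](probability_setT P).
under eq_integral do rewrite mgfE -sumEFin.
rewrite ge0_integral_sum//; first last.
- move=> b w _; rewrite lee_fin mulr_ge0// prodr_ge0//.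
- by move=> b; exact/measurable_EFinP.
under eq_bigr do rewrite intb.
rewrite sumEFin lee_fin.
rewrite -(bigA_distr_bigA (fun i (b : bool) => if b then p * m i else 1 - p)).
rewrite mulr_sumr expR_sum; apply: ler_prod => i _; rewrite big_bool /=.
have /andP[p0 p1] := p01.
rewrite addr_ge0 ?mulr_ge0 ?subr_ge0//=.
apply: le_trans (expR_ge1Dx _).
have : p * m i <= p * (1 + c i) by rewrite ler_wpM2l.
lra.
Qed.

Lemma chernoff_thinned (g : I -> R -> R) (c : I -> R) (t : R) :
  (forall i, measurable_fun setT (g i)) ->
  (forall i, \int[P]_w (expR (g i (eps i w)))%:E <= (1 + c i)%:E)%E ->
  (P [set w | t <= \sum_i (B i w)%:R * g i (eps i w)]%R
     <= (expR (p * \sum_i c i - t))%:E)%E.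
Proof.
move=> mg gc.
pose X w : R := \sum_i (B i w)%:R * g i (eps i w).
have mX : measurable_fun setT X.
  apply: measurable_sum => i; apply: measurable_funM; last exact: measurableT_comp.
  by apply: (measurableT_comp (f := fun b : bool => b%:R : R)).
have mA : measurable [set w | t <= X w].
  by have := measurable_fun_le measurableT (measurable_cst t) mX; rewrite setTI.
rewrite expRD EFinM -(mule1 (P _)).
have -> : (1 = (expR t)%:E * (expR (- t))%:E :> \bar R)%E.
  by rewrite -EFinM -expRD subrr expR0.
rewrite muleA lee_wpmul2r ?lee_fin ?expR_ge0//.
apply: le_trans (mgf_thinned mg gc).
set A := [set w | _] in mA *.
have -> : (P A * (expR t)%:E = \int[P]_w ((expR t)%:E * (\1_A w)%:E))%E.
  rewrite ge0_integralZl_EFin ?expR_ge0//; last first.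
    by apply/measurable_EFinP; exact: measurable_indic.
  by rewrite integral_indic// setIT muleC.
apply: ge0_le_integral => //.
- by apply/measurable_EFinP; apply: measurable_funM => //; exact: measurable_indic.
- by apply/measurable_EFinP; exact: measurableT_comp.
move=> w _; rewrite -EFinM lee_fin indicE.
have [tX|] := boolP (w \in _); last by rewrite mulr0 expR_ge0.
by rewrite mulr1 ler_expR; move: tX; rewrite inE.
Qed.

End thinned_sums.

(** * Tails of the residual statistic *)

Lemma expR_le_quadratic (R : realType) (x : R) : x <= 2^-1 ->
  expR x <= 1 + x + 2 * x ^+ 2.
Proof.
move=> x2; have x1 : 0 < 1 - x by lra.
have : expR x * (1 - x) <= 1.
  rewrite -[leRHS]expR0 -(subrr x) expRD ler_wpM2l ?expR_ge0//.
  exact: expR_ge1Dx.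
rewrite -ler_pdivlMr// => /le_trans; apply; rewrite ler_pdivrMr//.
have : 0 <= x ^+ 2 * (1 - 2 * x) by rewrite mulr_ge0 ?sqr_ge0//; lra.
lra.
Qed.

Section noise_mgf.
Context {d : measure_display} {Omega : measurableType d} {R : realType}.
Variables (P : probability Omega R) (e : {RV P >-> R}) (sigma U : R).
Hypothesis e_mean : ('E_P[e] = 0%:E)%E.
Hypothesis e_var : ('E_P[(fun w => e w ^+ 2)%R] = (sigma ^+ 2)%:E)%E.
Hypothesis e_bnd : {ae P, forall w, `|e w| <= U}.

(** Only the first two moments of the noise enter a quadratic majorant, and the
    linear coefficient c1 is killed by the zero mean. *)
Lemma noise_mgf_le (g : R -> R) (c0 c1 c2 : R) : measurable_fun setT g ->
  (forall x, `|x| <= U -> expR (g x) <= c0 + c1 * x + c2 * x ^+ 2) ->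
  (\int[P]_w (expR (g (e w)))%:E <= (c0 + c2 * sigma ^+ 2)%:E)%E.
Proof.
move=> mg gq.
have me : measurable_fun setT e by exact: measurable_funPT.
have me2 : measurable_fun setT (fun w => e w ^+ 2) by exact: measurable_funX.
have int2 : (\int[P]_w (e w ^+ 2)%:E = (sigma ^+ 2)%:E)%E.
  by rewrite -e_var unlock.
have int1 : (\int[P]_w (e w)%:E = 0)%E by have := e_mean; rewrite unlock.
have ie2 : P.-integrable setT (EFin \o (fun w => e w ^+ 2)).
  apply/integrableP; split; first exact/measurable_EFinP.
  rewrite (eq_integral (fun w => (e w ^+ 2)%:E)); last first.
    by move=> w _ /=; rewrite ger0_norm ?sqr_ge0.
  by rewrite int2 ltry.
have ic (c : R) : P.-integrable setT (EFin \o cst c).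
  exact: finite_measure_integrable_cst.
pose sq w := e w ^+ 2; pose one : Omega -> R := cst 1.
have ie : P.-integrable setT (EFin \o e).
  apply: (@le_integrable _ _ _ P setT measurableT _
     (fun w => (one w + sq w)%:E)).
  - exact/measurable_EFinP.
  - move=> w _ /=; rewrite lee_fin [leRHS]ger0_norm ?addr_ge0 ?sqr_ge0//.
    rewrite /one /sq /=; have := sqr_ge0 (`|e w| - 1); rewrite -(real_normK (num_real (e w))).
    have := sqr_ge0 (`|e w|); lra.
  - by apply: (integrableD measurableT (ic 1) ie2).
pose q w : R := c0 + c1 * e w + c2 * e w ^+ 2.
have iq : (\int[P]_w (q w)%:E = (c0 + c2 * sigma ^+ 2)%:E)%E.
  transitivity (\int[P]_w ((c0%:E + c1%:E * (e w)%:E) + c2%:E * (e w ^+ 2)%:E))%E.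
    by apply: eq_integral => w _; rewrite -!EFinM -!EFinD.
  have i1 : P.-integrable setT (fun w => c1%:E * (e w)%:E)%E by exact: integrableZl.
  have i2 : P.-integrable setT (fun w => c2%:E * (e w ^+ 2)%:E)%E by exact: integrableZl.
  rewrite integralD//; last by apply: integrableD => //; exact: ic.
  rewrite integralD//; last exact: ic.
  have intc : (\int[P]_w c0%:E = c0%:E)%E.
    rewrite integral_cst//; apply: (etrans (congr1 (mule _) (probability_setT P))).
    by rewrite mule1.
  by rewrite !integralZl// int1 int2 intc mule0 adde0 -EFinM -EFinD.
have mq : measurable_fun setT q.
  by apply: measurable_funD; [apply: measurable_funD => //|];
    apply: measurable_funM.
rewrite -iq.
have qae : {ae P, forall w, setT w -> (expR (g (e w)))%:E <= (q w)%:E}%E.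
  by apply: filterS e_bnd => w ew _; rewrite lee_fin; exact: gq.
apply: (@le_trans _ _ (\int[P]_w (Num.max (q w) 0)%:E)%E).
  apply: ae_ge0_le_integral => //.
  - by apply/measurable_EFinP; apply: measurableT_comp => //; exact: measurableT_comp.
  - by move=> w _; rewrite lee_fin le_max lexx orbT.
  - by apply/measurable_EFinP; exact: measurable_maxr.
  by apply: filterS qae => w qw wT; rewrite lee_fin le_max -!lee_fin qw.
rewrite le_eqVlt; apply/orP; left; apply/eqP.
apply: ae_eq_integral => //.
- by apply/measurable_EFinP; exact: measurable_maxr.
- exact/measurable_EFinP.
apply: filterS qae => w qw wT; congr EFin; apply: max_l.
by have := qw wT; rewrite lee_fin; apply: le_trans; exact: expR_ge0.
Qed.

End noise_mgf.

Section deviations.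
Context {d : measure_display} {Omega : measurableType d} {R : realType}.
Variables (P : probability Omega R) (I : finType).
Variables (B : I -> {RV P >-> bool}) (eps : I -> {RV P >-> R}) (p sigma U b : R).
Hypothesis p01 : 0 <= p <= 1.
Hypothesis B_indep : mutually_independent B.
Hypothesis B_distr : forall i, distribution P (B i) =1 bernoulli_prob p.
Hypothesis B_eps : independent_families B eps.
Hypothesis eps_indep : mutually_independent eps.
Hypothesis eps_mean : forall i, ('E_P[eps i] = 0%:E)%E.
Hypothesis eps_var : forall i, ('E_P[(fun w => eps i w ^+ 2)%R] = (sigma ^+ 2)%:E)%E.
Hypothesis eps_bnd : {ae P, forall w, forall i, `|eps i w| <= U}.
Hypotheses (sigma0 : 0 <= sigma) (U0 : 0 <= U) (b0 : 0 < b).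

(** A common bound, for |D| <= b and |x| <= U, of the increments
    |D^2 - 2 D x| and |(x - D)^2 - sigma^2| and of the variance factor
    b^2 + 4 sigma^2. *)
Definition noise_scale : R := (b + U + 2 * sigma) ^+ 2.
Local Notation Lam := noise_scale.

Let Lam0 : 0 < Lam.
Proof. by rewrite exprn_gt0//; move: sigma0 U0 b0; lra. Qed.

Let eps_bnd1 i : {ae P, forall w, `|eps i w| <= U}.
Proof. by apply: filterS eps_bnd => w; exact. Qed.

Let Lam_ge : (b + U) ^+ 2 + 4 * sigma ^+ 2 <= Lam.
Proof.
rewrite /noise_scale; have : 0 <= (b + U) * sigma by rewrite mulr_ge0// addr_ge0// ltW.
lra.
Qed.

(** With D = A - M0, the sum is the increase of the squared loss from M0 to A.
    The second moment of each term is at most a multiple of its mean p D_i^2,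
    so that a Chernoff parameter lam of constant order keeps half of the drift
    - lam p sum_i D_i^2. *)
Lemma excess_risk_lower_tail (D : I -> R) (t : R) : (forall i, `|D i| <= b) ->
  (P [set w | \sum_i (B i w)%:R * (D i ^+ 2 - 2 * D i * eps i w) <= t]%R
    <= (expR ((4 * Lam)^-1 * (t - p * (\sum_i D i ^+ 2) / 2)))%:E)%E.
Proof.
move=> Db; set lam := (4 * Lam)^-1.
have lam0 : 0 < lam by rewrite invr_gt0 mulr_gt0.
have lamL : 4 * (lam * Lam) = 1 by rewrite /lam; field; rewrite gt_eqF.
pose g i (x : R) : R := - (lam * (D i ^+ 2 - 2 * D i * x)).
have mg i : measurable_fun setT (g i).
  rewrite /g; apply: measurable_funN; apply: measurable_funM => //.
  by apply: measurable_funB => //; apply: measurable_funM.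
have D2b i : D i ^+ 2 <= b ^+ 2.
  by rewrite -real_normK ?num_real// lerXn2r ?nnegrE// ltW.
have gc i : (\int[P]_w (expR (g i (eps i w)))%:E <= (1 + - (lam * D i ^+ 2 / 2))%:E)%E.
  apply: (@le_trans _ _ (1 - lam * D i ^+ 2 + 2 * lam ^+ 2 * D i ^+ 4 +
      (8 * lam ^+ 2 * D i ^+ 2) * sigma ^+ 2)%:E).
    apply: (@noise_mgf_le _ _ _ P (eps i) sigma U _ _ _ (g i) _
      (2 * lam * D i - 8 * lam ^+ 2 * D i ^+ 3)) => // x xU.
    have gx : g i x <= 2^-1.
      have DxbU : `|D i * x| <= b * U by rewrite normrM ler_pM.
      have : - (D i ^+ 2 - 2 * D i * x) <= 2 * Lam.
        have := ler_norm (D i * x); have := sqr_ge0 (D i).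
        have : 2 * (b * U) <= (b + U) ^+ 2.
          by have := sqr_ge0 b; have := sqr_ge0 U; lra.
        have := sqr_ge0 sigma; move: Lam0 Lam_ge DxbU; lra.
      move=> h; have : lam * - (D i ^+ 2 - 2 * D i * x) <= lam * (2 * Lam).
        by rewrite ler_pM2l.
      by rewrite mulrN => /le_trans; apply; move: lamL; lra.
    apply: le_trans (expR_le_quadratic gx) _.
    by rewrite le_eqVlt; apply/orP; left; apply/eqP; rewrite /g; ring.
  rewrite lee_fin.
  have lamD : lam * (D i ^+ 2 + 4 * sigma ^+ 2) <= lam * Lam.
    rewrite ler_pM2l//.
    have : b ^+ 2 <= (b + U) ^+ 2 by rewrite lerXn2r ?nnegrE ?addr_ge0 ?(ltW b0)// lerDl.
    by move: (D2b i) Lam_ge; lra.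
  have lD0 : 0 <= lam * D i ^+ 2 by rewrite mulr_ge0 ?sqr_ge0// ltW.
  have lamD4 : 4 * (lam * (D i ^+ 2 + 4 * sigma ^+ 2)) <= 1 by move: lamD lamL; lra.
  have := ler_wpM2l lD0 lamD4.
  have -> : D i ^+ 4 = D i ^+ 2 * D i ^+ 2 by rewrite -exprD.
  lra.
have := chernoff_thinned p01 B_indep B_distr B_eps eps_indep (- (lam * t)) mg gc.
have -> : [set w | \sum_i (B i w)%:R * (D i ^+ 2 - 2 * D i * eps i w) <= t]%R =
   [set w | - (lam * t) <= \sum_i (B i w)%:R * g i (eps i w)]%R.
  have gE w : \sum_i (B i w)%:R * g i (eps i w) =
      - (lam * \sum_i (B i w)%:R * (D i ^+ 2 - 2 * D i * eps i w)).
    rewrite mulr_sumr -sumrN; apply: eq_bigr => i _.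
    by rewrite /g mulrN mulrCA.
  by apply/seteqP; split => w /=; rewrite gE lerN2 ler_pM2l.
move=> /le_trans; apply; rewrite lee_fin ler_expR le_eqVlt; apply/orP; left; apply/eqP.
rewrite sumrN -mulr_suml -mulr_sumr; ring.
Qed.

(** Here the terms do not vanish with D: the quadratic term contributes
    p |I| (mu Lam)^2, and mu is to be taken of order 1 / sqrt (p |I|) or
    smaller.  The sign s serves both tails. *)
Lemma residual_tail (D : I -> R) (s mu t : R) : (forall i, `|D i| <= b) ->
  `|s| <= 1 -> 0 < mu -> 2 * mu * Lam <= 1 ->
  (P [set w | t <= \sum_i (B i w)%:R * (s * ((eps i w - D i) ^+ 2 - sigma ^+ 2))]%R
    <= (expR (p * (mu * s * (\sum_i D i ^+ 2) + 2 * (mu * Lam) ^+ 2 * #|I|%:R) - mu * t))%:E)%E.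
Proof.
move=> Db s1 mu0 muL.
pose g i (x : R) : R := mu * (s * ((x - D i) ^+ 2 - sigma ^+ 2)).
have mg i : measurable_fun setT (g i).
  rewrite /g; apply: measurable_funM => //; apply: measurable_funM => //.
  by apply: measurable_funB => //; apply: measurable_funX; exact: measurable_funB.
have gc i : (\int[P]_w (expR (g i (eps i w)))%:E <=
    (1 + (mu * s * D i ^+ 2 + 2 * (mu * Lam) ^+ 2))%:E)%E.
  have -> : 1 + (mu * s * D i ^+ 2 + 2 * (mu * Lam) ^+ 2) =
    (1 + mu * s * (D i ^+ 2 - sigma ^+ 2) + 2 * (mu * Lam) ^+ 2) + (mu * s) * sigma ^+ 2.
    by ring.
  apply: (@noise_mgf_le _ _ _ P (eps i) sigma U _ _ _ (g i) _
      (- (2 * mu * s * D i))) => // x xU.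
  have xD : (x - D i) ^+ 2 <= (b + U) ^+ 2.
    rewrite -real_normK ?num_real// lerXn2r ?nnegrE ?addr_ge0 ?(ltW b0)//.
    by rewrite [leRHS]addrC (le_trans (ler_normB _ _))// lerD.
  have gLam : `|s * ((x - D i) ^+ 2 - sigma ^+ 2)| <= Lam.
    rewrite normrM; apply: (@le_trans _ _ (1 * Lam)); last by rewrite mul1r.
    rewrite ler_pM// ler_norml.
    move: (sqr_ge0 (x - D i)) (sqr_ge0 sigma) (sqr_ge0 (b + U)) Lam_ge xD.
    by move=> *; apply/andP; split; lra.
  have gn : `|g i x| <= mu * Lam.
    by rewrite /g normrM (gtr0_norm mu0) ler_pM2l.
  have gx : g i x <= 2^-1 by apply: (le_trans (ler_norm _)); move: gn muL; lra.
  apply: le_trans (expR_le_quadratic gx) _.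
  have g2 : g i x ^+ 2 <= (mu * Lam) ^+ 2.
    by rewrite -real_normK ?num_real// lerXn2r ?nnegrE// mulr_ge0// ltW.
  apply: (@le_trans _ _ (1 + g i x + 2 * (mu * Lam) ^+ 2)).
    by rewrite lerD2l ler_pM2l.
  by rewrite le_eqVlt; apply/orP; left; apply/eqP; rewrite /g; ring.
have := chernoff_thinned p01 B_indep B_distr B_eps eps_indep (mu * t) mg gc.
have -> : [set w | t <= \sum_i (B i w)%:R * (s * ((eps i w - D i) ^+ 2 - sigma ^+ 2))]%R =
   [set w | mu * t <= \sum_i (B i w)%:R * g i (eps i w)]%R.
  have gE w : \sum_i (B i w)%:R * g i (eps i w) =
      mu * \sum_i (B i w)%:R * (s * ((eps i w - D i) ^+ 2 - sigma ^+ 2)).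
    by rewrite mulr_sumr; apply: eq_bigr => i _; rewrite /g mulrCA.
  by apply/seteqP; split => w /=; rewrite gE ler_pM2l.
move=> /le_trans; apply; rewrite lee_fin ler_expR le_eqVlt; apply/orP; left; apply/eqP.
by rewrite big_split /= -mulr_sumr sumr_const -[_ *+ #|I|]mulr_natr.
Qed.

End deviations.

(** * Acceptance of net points and its measurability *)

Section acceptance.
Context {R : realType} {m1 m2 : nat}.
Implicit Types (A M : 'M[R]_(m1, m2)) (x : data R m1 m2).

Definition residual (sigma : R) A x : R :=
  \sum_(ij : 'I_m1 * 'I_m2)
    (x ij.1 ij.2).1%:R * (((x ij.1 ij.2).2 - A ij.1 ij.2) ^+ 2 - sigma ^+ 2).

Definition accepted (sigma thr : R) (s : seq 'M[R]_(m1, m2)) x :=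
  [seq A <- s | residual sigma A x <= thr].

Local Notation dataT := (g_sigma_algebraType
  (\bigcup_(ij in [set: 'I_m1 * 'I_m2]) preimage_set_system setT
    (fun x : data R m1 m2 => x ij.1 ij.2) measurable)).

Lemma measurable_coord ij :
  measurable_fun setT ((fun x => x ij.1 ij.2) : dataT -> bool * R).
Proof.
move=> _ Y mY; apply: sub_sigma_algebra; exists ij => //; exists Y => //.
Qed.

Lemma measurable_residual sigma A :
  measurable_fun setT (residual sigma A : dataT -> R).
Proof.
apply: measurable_sum => ij; apply: measurable_funM.
  apply: (measurableT_comp (f := fun b : bool => b%:R : R)) => //.
  by apply: (measurableT_comp measurable_fst); exact: measurable_coord.
apply: measurable_funB => //; apply: measurable_funX; apply: measurable_funB => //.
by apply: (measurableT_comp measurable_snd); exact: measurable_coord.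
Qed.

(** The accepted subsequence takes finitely many values, on each of which
    it is determined by finitely many events residual A <= thr. *)
Lemma data_measurable_accepted sigma thr s 
    (Q : data R m1 m2 -> seq 'M[R]_(m1, m2) -> Prop) :
  (forall l, data_measurable [set x | Q x l]) ->
  data_measurable [set x | Q x (accepted sigma thr s x)].
Proof.
elim: s Q => [|A s IH] Q mQ; first exact: mQ.
pose pass : set (data R m1 m2) := [set x | residual sigma A x <= thr].
have mpass : @measurable _ dataT pass.
  by have := measurable_fun_le measurableT (measurable_residual sigma A) (measurable_cst thr);
    rewrite setTI.
have m1' : @measurable _ dataT [set x | Q x (A :: accepted sigma thr s x)].
  by apply: (IH (fun x l => Q x (A :: l))) => l; exact: mQ.
have m2' : @measurable _ dataT [set x | Q x (accepted sigma thr s x)] by apply: (IH Q).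
have : @measurable _ dataT ((pass `&` [set x | Q x (A :: accepted sigma thr s x)]) `|`
    (~` pass `&` [set x | Q x (accepted sigma thr s x)])).
  by apply: measurableU; apply: measurableI => //; exact: measurableC.
congr (data_measurable _); apply/seteqP; split => x /=.
  rewrite /accepted /pass /= => -[[h Qx]|[h Qx]]; first by rewrite h.
  by move/negP/negPf: h => ->.
rewrite /accepted /pass /=; case: ifP => h Qx; [left|right] => //.
Qed.

End acceptance.

Section observing.
Context {R : realType} {m1 m2 : nat}.
Context {d : measure_display} {Omega : measurableType d}.
Variables (P : probability Omega R).
Variables (B : 'I_m1 * 'I_m2 -> {RV P >-> bool}) (eps : 'I_m1 * 'I_m2 -> {RV P >-> R}).

Lemma measurable_observation (M : 'M[R]_(m1, m2)) E :
  data_measurable E -> measurable (observation B eps M @^-1` E).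
Proof.
move=> mE.
pose G := \bigcup_(ij in [set: 'I_m1 * 'I_m2]) preimage_set_system setT
    (fun x : data R m1 m2 => x ij.1 ij.2) measurable.
have mobs : measurable_fun setT (observation B eps M : Omega -> g_sigma_algebraType G).
  apply: (@measurability _ _ Omega (g_sigma_algebraType G) setT
    (observation B eps M) G erefl) => _ [_ [ij _ [Y mY <-]] <-].
  rewrite !setTI.
  have -> : observation B eps M @^-1` ((fun x : data R m1 m2 => x ij.1 ij.2) @^-1` Y) =
    setT `&` (fun w => (B ij w, (B ij w)%:R * (M ij.1 ij.2 + eps ij w))) @^-1` Y.
    by rewrite setTI; apply/seteqP; split => w /=; rewrite /observation mxE -surjective_pairing.
  have mpair : measurable_fun setT
      (fun w => (B ij w, (B ij w)%:R * (M ij.1 ij.2 + eps ij w)) : bool * R).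
    apply: measurable_fun_pair => //; apply: measurable_funM.
      by apply: (measurableT_comp (f := fun b : bool => b%:R : R)).
    by apply: measurable_funD.
  exact: mpair.
have := mobs measurableT E mE; by rewrite setTI.
Qed.

Lemma residual_observation (sigma : R) (M A : 'M[R]_(m1, m2)) w :
  residual sigma A (observation B eps M w) =
  \sum_ij (B ij w)%:R * ((eps ij w - (A - M) ij.1 ij.2) ^+ 2 - sigma ^+ 2).
Proof.
apply: eq_bigr => -[i j] _; rewrite !mxE /=; case: (B (i, j) w) => /=.
  by rewrite !mul1r; congr (_ ^+ 2 - _); ring.
by rewrite !mul0r.
Qed.

End observing.

(** * Near points are accepted, far points are rejected *)

Section union_bound.
Context {d : measure_display} {Omega : measurableType d} {R : realType}.
Variables (P : probability Omega R) (T : eqType) (E : T -> set Omega).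
Hypothesis mE : forall x, measurable (E x).

Lemma measurable_exists_seq (s : seq T) :
  measurable [set w | exists2 x, x \in s & E x w].
Proof.
elim: s => [|x s IH].
  rewrite (_ : [set w | _] = set0); first exact: measurable0.
  by apply/seteqP; split => w //= [x].
rewrite (_ : [set w | _] = E x `|` [set w | exists2 x, x \in s & E x w]).
  exact: measurableU.
apply/seteqP; split => w /= [].
- by move=> y; rewrite inE => /orP[/eqP->|ys] Ey; [left|right; exists y].
- by move=> Ex; exists x => //; rewrite mem_head.
- by move=> [y ys Ey]; exists y => //; rewrite inE ys orbT.
Qed.

Lemma union_bound_seq (s : seq T) :
  (P [set w | exists2 x, x \in s & E x w] <= \sum_(x <- s) P (E x))%E.
Proof.
elim: s => [|x s IH].
  rewrite (_ : [set w | _] = set0); first by rewrite measure0 big_nil.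
  by apply/seteqP; split => w //= [x].
rewrite big_cons (_ : [set w | _] = E x `|` [set w | exists2 x, x \in s & E x w]).
  apply: le_trans (leeD2l _ IH).
  by apply: measureU2 => //; exact: measurable_exists_seq.
apply/seteqP; split => w /= [].
- by move=> y; rewrite inE => /orP[/eqP->|ys] Ey; [left|right; exists y].
- by move=> Ex; exists x => //; rewrite mem_head.
- by move=> [y ys Ey]; exists y => //; rewrite inE ys orbT.
Qed.

End union_bound.

(** Chosen so that a Chernoff parameter 1 / (2 Lam d) leaves a probability of
    at most exp(- 1 / beta) <= beta. *)
Definition threshold (R : realType) (Lam beta : R) : R := 1 + 2 * Lam * (1 + beta^-1).

Section model_tails.
Context {R : realType}.
Variables (a U sigma beta : R) (m1 m2 n : nat).
Hypotheses (a0 : 0 < a) (U0 : 0 < U) (sigma0 : 0 < sigma) (beta0 : 0 < beta).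
Hypotheses (m10 : (0 < m1)%N) (m20 : (0 < m2)%N) (n0 : (0 < n)%N) (nm : (n <= m1 * m2)%N).
Context {d : measure_display} {Omega : measurableType d}.
Variables (P : probability Omega R).
Variables (B : 'I_m1 * 'I_m2 -> {RV P >-> bool}) (eps : 'I_m1 * 'I_m2 -> {RV P >-> R}).
Local Notation p := (n%:R / (m1 * m2)%:R : R).
Hypothesis design : bernoulli_design B eps p.
Hypothesis noise : noise_assumption eps sigma U.

Local Notation Lam := (noise_scale sigma U (2 * a)).
Local Notation tau := (threshold Lam beta).
Local Notation sq_rate k := ((m1 * m2 * k * (m1 + m2))%:R / n%:R : R).

Lemma sampling_rate01 : 0 <= p <= 1.
Proof.
rewrite divr_ge0 ?ler0n//= ler_pdivrMr ?mul1r ?ler_nat// ltr0n.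
by rewrite muln_gt0 m10.
Qed.

Lemma noise_scale_gt0 : 0 < Lam.
Proof. by rewrite exprn_gt0//; move: a0 U0 sigma0; lra. Qed.

Lemma threshold_slack_ge0 : 0 <= 2 * Lam * (1 + beta^-1).
Proof.
apply: mulr_ge0; last by rewrite addr_ge0// invr_ge0 ltW.
by apply: mulr_ge0 => //; exact: ltW noise_scale_gt0.
Qed.

Lemma rate_identity k : p * sq_rate k = (k * (m1 + m2))%:R.
Proof.
have m1R : m1%:R != 0 :> R by rewrite pnatr_eq0 -lt0n.
have m2R : m2%:R != 0 :> R by rewrite pnatr_eq0 -lt0n.
have nR : n%:R != 0 :> R by rewrite pnatr_eq0 -lt0n.
by rewrite !natrM; field; rewrite m1R m2R nR.
Qed.

Lemma measurable_residual_observation (M A : 'M[R]_(m1, m2)) :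
  measurable_fun setT (fun w => residual sigma A (observation B eps M w)).
Proof.
rewrite (_ : (fun w => _) = fun w =>
    \sum_ij (B ij w)%:R * ((eps ij w - (A - M) ij.1 ij.2) ^+ 2 - sigma ^+ 2)); last first.
  by apply/funext => w; rewrite residual_observation.
apply: measurable_sum => ij; apply: measurable_funM.
  by apply: (measurableT_comp (f := fun b : bool => b%:R : R)).
by apply: measurable_funB => //; apply: measurable_funX; apply: measurable_funB.
Qed.

Lemma measurable_residual_le (M A : 'M[R]_(m1, m2)) (t : R) :
  measurable [set w | residual sigma A (observation B eps M w) <= t].
Proof.
have := measurable_fun_le measurableT (measurable_residual_observation M A) (measurable_cst t).
by rewrite setTI.
Qed.

Lemma measurable_residual_gt (M A : 'M[R]_(m1, m2)) (t : R) :
  measurable [set w | t < residual sigma A (observation B eps M w)].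
Proof.
rewrite (_ : [set w | _] = ~` [set w | residual sigma A (observation B eps M w) <= t]).
  by apply: measurableC; exact: measurable_residual_le.
by apply/seteqP; split => w /=; rewrite ltNge => /negP.
Qed.

Lemma entry_diff_le (A M : 'M[R]_(m1, m2)) : `|A| <= a -> `|M| <= a ->
  forall ij : 'I_m1 * 'I_m2, `|(A - M) ij.1 ij.2| <= 2 * a.
Proof.
move=> Aa Ma ij; rewrite !mxE mulr2n mulrDl mul1r.
by apply: (le_trans (ler_normB _ _)); apply: lerD; apply: (le_trans (entry_le_norm _ _ _)).
Qed.

Lemma frob2_pair (A : 'M[R]_(m1, m2)) : \sum_ij A ij.1 ij.2 ^+ 2 = frob2 A.
Proof. by rewrite /frob2 pair_bigA. Qed.

(** With mu = 1 / (2 Lam d) the quadratic term 2 (mu Lam)^2 n of the exponent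
   is at most 1/2, since n <= m1 m2 <= d^2. *)
Let side_tail (D : 'I_m1 * 'I_m2 -> R) (s t x : R) : (forall ij, `|D ij| <= 2 * a) ->
  `|s| <= 1 ->
  p * (s * \sum_ij D ij ^+ 2) <= x * (m1 + m2)%:R ->
  (x + 2 * Lam * (1 + beta^-1)) * (m1 + m2)%:R <= t ->
  (P [set w | t <= \sum_ij (B ij w)%:R * (s * ((eps ij w - D ij) ^+ 2 - sigma ^+ 2))]%R
    <= beta%:E)%E.
Proof.
move=> Db s1 px xt.
have [Bi Bd Be] := design; have [ei em ev eb] := noise.
have a20 : 0 < 2 * a by rewrite mulr_gt0.
have := fun mu => residual_tail sampling_rate01 Bi Bd Be ei em ev eb
  (ltW sigma0) (ltW U0) a20 t Db s1 (mu := mu).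
move: (Lam) noise_scale_gt0 xt => L L0 xt tail.
pose dd : R := (m1 + m2)%:R.
have dd1 : 1 <= dd by rewrite ler1n addn_gt0 m10.
have dd0 : 0 < dd by apply: lt_le_trans dd1.
pose mu : R := (2 * L * dd)^-1.
have mu0 : 0 < mu by rewrite invr_gt0 !mulr_gt0.
have muL : mu * L * (2 * dd) = 1.
  by rewrite /mu; field; rewrite -natrD !gt_eqF.
clearbody mu.
have muL1 : 2 * mu * L <= 1.
  have : 0 <= (mu * L) * (dd - 1).
    by rewrite mulr_ge0 ?subr_ge0// mulr_ge0// ltW.
  by move: muL; lra.
have := tail mu mu0 muL1.
move=> /le_trans; apply; rewrite lee_fin.
apply: (@le_trans _ _ (expR (- beta^-1))); last first.
  rewrite expRN -[leRHS]invrK lef_pV2 ?posrE ?expR_gt0 ?invr_gt0//.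
  by have := expR_ge1Dx beta^-1; lra.
rewrite ler_expR.
have pI : p * #|{: 'I_m1 * 'I_m2}|%:R = n%:R.
  by rewrite card_prod !card_ord divfK// pnatr_eq0 -lt0n muln_gt0 m10.
have n_dd : n%:R <= dd ^+ 2.
  rewrite -natrX ler_nat (leq_trans nm)// expnS expn1.
  by rewrite leq_mul ?leq_addr ?leq_addl.
have e1 : mu * (p * (s * \sum_ij D ij ^+ 2)) <= mu * (x * dd) by rewrite ler_pM2l.
have e2 : 2 * (mu * L) ^+ 2 * n%:R <= 2^-1.
  apply: (@le_trans _ _ (2 * (mu * L) ^+ 2 * dd ^+ 2)).
    by rewrite ler_wpM2l// mulr_ge0 ?sqr_ge0.
  have : (mu * L * (2 * dd)) ^+ 2 = 1 by rewrite muL expr1n.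
  lra.
have e3 : mu * ((x + 2 * L * (1 + beta^-1)) * dd) <= mu * t by rewrite ler_pM2l.
have e4 : mu * (2 * L * (1 + beta^-1) * dd) = 1 + beta^-1.
  have -> : mu * (2 * L * (1 + beta^-1) * dd) = mu * L * (2 * dd) * (1 + beta^-1) by ring.
  by rewrite muL mul1r.
have -> : p * (mu * s * (\sum_ij D ij ^+ 2) + 2 * (mu * L) ^+ 2 * #|{: 'I_m1 * 'I_m2}|%:R) =
   mu * (p * (s * \sum_ij D ij ^+ 2)) + 2 * (mu * L) ^+ 2 * (p * #|{: 'I_m1 * 'I_m2}|%:R) by ring.
rewrite pI; move: e1 e2 e3 e4; rewrite !mulrDl !mulrDr; lra.
Qed.

Lemma near_accepted k (A M : 'M[R]_(m1, m2)) : (0 < k)%N ->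
  `|A| <= a -> `|M| <= a -> frob2 (A - M) <= sq_rate k ->
  (P [set w | tau * (k * (m1 + m2))%:R < residual sigma A (observation B eps M w)]%R
    <= beta%:E)%E.
Proof.
move=> k0 Aa Ma AM.
apply: (@le_trans _ _ (P [set w | tau * (k * (m1 + m2))%:R <=
   \sum_ij (B ij w)%:R * (1 * ((eps ij w - (A - M) ij.1 ij.2) ^+ 2 - sigma ^+ 2))]%R)).
  have resE w : residual sigma A (observation B eps M w) =
      \sum_ij (B ij w)%:R * (1 * ((eps ij w - (A - M) ij.1 ij.2) ^+ 2 - sigma ^+ 2)).
    by rewrite residual_observation; apply: eq_bigr => ij _; rewrite mul1r.
  apply: le_measure; rewrite ?inE.
  - exact: measurable_residual_gt.
  - have := measurable_fun_le measurableT (measurable_cst (tau * (k * (m1 + m2))%:R))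
      (measurable_residual_observation M A).
    by rewrite setTI; congr (measurable _); apply/seteqP; split => w /=; rewrite resE.
  - by move=> w /=; rewrite -resE => /ltW.
apply: (@side_tail _ 1 _ k%:R (entry_diff_le Aa Ma)); first by rewrite normr1.
  by rewrite mul1r frob2_pair -natrM -rate_identity ler_wpM2l//.
have X0 := threshold_slack_ge0.
rewrite natrM mulrA ler_wpM2r ?ler0n// /threshold.
move: (2 * Lam * (1 + beta^-1)) X0 => X X0.
have : X <= X * k%:R by rewrite ler_peMr// ler1n.
lra.
Qed.

Lemma noise_level_lower (M : 'M[R]_(m1, m2)) :
  (P [set w | residual sigma M (observation B eps M w) <= - (tau * (m1 + m2)%:R)]%R
    <= beta%:E)%E.
Proof.
have -> : [set w | residual sigma M (observation B eps M w) <= - (tau * (m1 + m2)%:R)] =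
  [set w | tau * (m1 + m2)%:R <=
   \sum_ij (B ij w)%:R * (-1 * ((eps ij w - cst 0 ij) ^+ 2 - sigma ^+ 2))].
  have E w : \sum_ij (B ij w)%:R * (-1 * ((eps ij w - cst 0 ij) ^+ 2 - sigma ^+ 2)) =
     - residual sigma M (observation B eps M w).
    rewrite residual_observation -sumrN; apply: eq_bigr => ij _.
    by rewrite subrr mxE mulN1r mulrN.
  by apply/seteqP; split => w /=; rewrite E lerNr.
apply: (@side_tail (cst 0) (-1) _ 1) => //.
- by move=> ij; rewrite normr0 mulr_ge0// ltW.
- by rewrite normrN1.
- by rewrite big1 ?mulr0 ?mul1r ?ler0n// => ij _; rewrite expr0n.
Qed.

Lemma measurable_far_accepted (s : seq 'M[R]_(m1, m2)) (M : 'M[R]_(m1, m2)) (rho t : R) :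
  measurable [set w | exists2 A, A \in s & rho < frob2 (A - M) /\
      residual sigma A (observation B eps M w) <= t].
Proof.
rewrite (_ : [set w | _] = [set w |
    exists2 A, A \in [seq A <- s | rho < frob2 (A - M)] &
      [set w | residual sigma A (observation B eps M w) <= t] w]).
  by apply: measurable_exists_seq => A; exact: measurable_residual_le.
apply/seteqP; split => w /= [A].
  by move=> As [far le]; exists A => //; rewrite mem_filter far.
by rewrite mem_filter => /andP[far As] le; exists A.
Qed.

(** If A is accepted and the residual of M is at least - tau d, then the excess
    squared loss of A over M is at most T = 2 tau k d, which for a far A has
    the small probability given by [excess_risk_lower_tail]. *)
Lemma far_rejected k r (s : seq 'M[R]_(m1, m2)) (M : 'M[R]_(m1, m2)) (J : nat) :
  (0 < k)%N -> 0 < r -> r ^+ 2 = sq_rate k ->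
  (forall A, A \in s -> `|A| <= a) -> `|M| <= a ->
  \sum_(A <- s | J%:R ^+ 2 * r ^+ 2 < frob2 (A - M))
      expR ((k * (m1 + m2))%:R *
        (2 * (4 * Lam)^-1 * tau - (4 * Lam)^-1 / 2 * (frob2 (A - M) / r ^+ 2)))
    <= beta ->
  (P [set w | exists2 A, A \in s & J%:R ^+ 2 * r ^+ 2 < frob2 (A - M) /\
      residual sigma A (observation B eps M w) <= tau * (k * (m1 + m2))%:R]%R
    <= (beta + beta)%:E)%E.
Proof.
move=> k0 r0 rE sa Ma tail.
have [Bi Bd Be] := design; have [ei em ev eb] := noise.
pose sf := [seq A <- s | J%:R ^+ 2 * r ^+ 2 < frob2 (A - M)].
pose T : R := 2 * (tau * (k * (m1 + m2))%:R).
pose EA (A : 'M[R]_(m1, m2)) := [set w | residual sigma A (observation B eps M w) -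
    residual sigma M (observation B eps M w) <= T].
have mEA A : measurable (EA A).
  have := measurable_fun_le measurableT
    (measurable_funB (measurable_residual_observation M A) (measurable_residual_observation M M))
    (measurable_cst T).
  by rewrite setTI.
pose E0 := [set w | residual sigma M (observation B eps M w) <= - (tau * (m1 + m2)%:R)].
have mE0 : measurable E0 by exact: measurable_residual_le.
have tau0 : 0 <= tau by rewrite addr_ge0// threshold_slack_ge0.
have mE1 : measurable [set w | exists2 A, A \in sf & EA A w] by exact: measurable_exists_seq.
apply: (@le_trans _ _ (P (E0 `|` [set w | exists2 A, A \in sf & EA A w]))).
  apply: le_measure; rewrite ?inE.
  - exact: measurable_far_accepted.
  - exact: measurableU.
  - move=> w /= [A As [far le]].
    have [h|h] := leP (residual sigma M (observation B eps M w)) (- (tau * (m1 + m2)%:R)).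
      by left.
    right; exists A; first by rewrite mem_filter far.
    rewrite /EA /=; have : tau * (m1 + m2)%:R <= tau * (k * (m1 + m2))%:R.
      by rewrite ler_wpM2l// ler_nat leq_pmull.
    by move: le h; rewrite /T; lra.
apply: (le_trans (measureU2 _ mE0 mE1)); rewrite EFinD; apply: leeD.
  exact: noise_level_lower.
apply: (le_trans (union_bound_seq _ mEA _)).
apply: (@le_trans _ _ (\sum_(A <- sf) (expR ((k * (m1 + m2))%:R *
   (2 * (4 * Lam)^-1 * tau - (4 * Lam)^-1 / 2 * (frob2 (A - M) / r ^+ 2))))%:E)%E); last first.
  by rewrite sumEFin lee_fin /sf big_filter.
rewrite big_seq [leRHS]big_seq; apply: lee_sum => A; rewrite mem_filter => /andP[_ As].
have a20 : 0 < 2 * a by rewrite mulr_gt0.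
have Db := entry_diff_le (sa A As) Ma.
have := excess_risk_lower_tail sampling_rate01 Bi Bd Be ei em ev eb (ltW sigma0) (ltW U0) a20 T Db.
have -> : [set w | \sum_i (B i w)%:R *
    ((A - M) i.1 i.2 ^+ 2 - 2 * (A - M) i.1 i.2 * eps i w) <= T]%R
   = EA A.
  have E w : residual sigma A (observation B eps M w) -
      residual sigma M (observation B eps M w) =
      \sum_i (B i w)%:R * ((A - M) i.1 i.2 ^+ 2 - 2 * (A - M) i.1 i.2 * eps i w).
    rewrite !residual_observation -sumrB; apply: eq_bigr => ij _.
    by rewrite subrr [(0 : 'M[R]_(m1, m2)) _ _]mxE; ring.
  by apply/seteqP; split => w; rewrite /EA /= E.
move=> /le_trans; apply; rewrite lee_fin ler_expR frob2_pair.
rewrite le_eqVlt; apply/orP; left; apply/eqP.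
have pr : p * frob2 (A - M) = (k * (m1 + m2))%:R * (frob2 (A - M) / r ^+ 2).
  rewrite -rate_identity -rE -[in RHS]mulrA; congr (_ * _).
  by rewrite [in RHS]mulrC divfK// gt_eqF// exprn_gt0.
rewrite pr /T; ring.
Qed.

End model_tails.

(** * The two-scale confidence set *)

Section two_scale_set.
Context {R : realType} {m1 m2 : nat}.
Variables (sigma : R) (Theta : set 'M[R]_(m1, m2)).

Definition ball_in (A : 'M[R]_(m1, m2)) (rho : R) : set 'M[R]_(m1, m2) :=
  [set M | Theta M /\ frob2 (A - M) <= rho].

Definition two_scale_set (s0 s1 : seq 'M[R]_(m1, m2)) (t0 t1 rho0 rho1 : R)
    (x : data R m1 m2) : set 'M[R]_(m1, m2) :=
  match accepted sigma t0 s0 x, accepted sigma t1 s1 x with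
  | A :: _, _ => ball_in A rho0
  | [::], A :: _ => ball_in A rho1
  | [::], [::] => set0
  end.

Lemma data_measurable_cst (Q : Prop) : data_measurable [set x : data R m1 m2 | Q].
Proof.
pose T := g_sigma_algebraType (\bigcup_(ij in [set: 'I_m1 * 'I_m2])
  preimage_set_system setT (fun x : data R m1 m2 => x ij.1 ij.2) measurable).
have [q|nq] := pselect Q.
  rewrite (_ : [set x | Q] = setT); last by apply/seteqP; split.
  exact: (@measurableT _ T).
rewrite (_ : [set x | Q] = set0); last by apply/seteqP; split.
exact: (@measurable0 _ T).
Qed.

Lemma confidence_set_two_scale s0 s1 t0 t1 rho0 rho1 :
  confidence_set Theta (two_scale_set s0 s1 t0 t1 rho0 rho1).
Proof.
have mQ (Q : set 'M[R]_(m1, m2) -> Prop) :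
    data_measurable [set x | Q (two_scale_set s0 s1 t0 t1 rho0 rho1 x)].
  apply: (@data_measurable_accepted R m1 m2 sigma t0 s0 (fun x l =>
    Q (match l, accepted sigma t1 s1 x with
    | A :: _, _ => ball_in A rho0 | [::], A :: _ => ball_in A rho1 | [::], [::] => set0 end))).
  move=> l0; apply: (@data_measurable_accepted R m1 m2 sigma t1 s1 (fun x l => Q (match l0, l with
    | A :: _, _ => ball_in A rho0 | [::], A :: _ => ball_in A rho1 | [::], [::] => set0 end))).
  by move=> l1; exact: data_measurable_cst.
split.
- move=> x M; rewrite /two_scale_set.
  by case: (accepted _ t0 _ _) => [|A _]; [case: (accepted _ _ _ _) => [|A _]|] => // -[].
- by move=> M0 _; exact: (mQ (fun S => S M0)).
- by move=> r; exact: (mQ (fun S => (r%:E < frobenius_diam S)%E)).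
Qed.

Lemma frobenius_diam_ball A (rho : R) : 0 <= rho ->
  (frobenius_diam (ball_in A (rho ^+ 2)) <= (2 * rho)%:E)%E.
Proof.
move=> rho0; apply: ge_ereal_sup => _ [x [_ xA]] [y [_ yA]] <-.
rewrite lee_fin /frobenius -/(frob2 _).
rewrite -[leRHS]ger0_norm ?mulr_ge0// -sqrtr_sqr ler_wsqrtr//.
rewrite (_ : x - y = (A - y) - (A - x)); last by apply/matrixP => i j; rewrite !mxE; ring.
apply: le_trans (frob2B _ _) _; move: xA yA; lra.
Qed.

Lemma frobenius_diam_two_scale s0 s1 t0 t1 (rho0 rho1 : R) x : 0 <= rho0 -> rho0 <= rho1 ->
  (frobenius_diam (two_scale_set s0 s1 t0 t1 (rho0 ^+ 2) (rho1 ^+ 2) x) <= (2 * rho1)%:E)%E.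
Proof.
move=> r0 r01; rewrite /two_scale_set.
case: (accepted _ t0 _ _) => [|A _]; last first.
  by apply: (le_trans (frobenius_diam_ball _ r0)); rewrite lee_fin ler_pM2l.
case: (accepted _ _ _ _) => [|A _]; first last.
  by apply: frobenius_diam_ball; exact: le_trans r01.
by apply: ge_ereal_sup => _ [? []].
Qed.

End two_scale_set.

Theorem corollary5p1 (R : realType) (alpha alpha' a U sigma : R)
    (a_gt0 : 0 < a) (U_gt0 : 0 < U) (sigma_gt0 : 0 < sigma) :
  exists2 K : R, 0 < K &
  forall (m1 m2 n k0 k : nat),
  let m := minn m1 m2 in
  let d := (m1 + m2)%N in
  2 / d%:R <= alpha ->
  12 * expR (- (100 * d%:R)) <= alpha' ->
  (n <= m1 * m2)%N ->
  m%:R * ln (d%:R : R) <= n%:R ->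
  (1 <= k0)%N -> (k0 < k)%N -> (k <= m)%N ->
  exists C : data R m1 m2 -> set 'M[R]_(m1, m2),
    confidence_set (mx_class a k) C /\
    forall (disp : measure_display) (Omega : measurableType disp)
      (P : probability Omega R)
      (B : 'I_m1 * 'I_m2 -> {RV P >-> bool})
      (eps : 'I_m1 * 'I_m2 -> {RV P >-> R}),
    bernoulli_design B eps (n%:R / (m1 * m2)%:R) ->
    noise_assumption eps sigma U ->
    [/\ honest B eps (mx_class a k) alpha C,
        diam_controlled B eps (mx_class a k0) alpha'
          (K * Num.sqrt ((m1 * m2 * k0 * d)%:R / n%:R)) C &
        diam_controlled B eps (mx_class a k) alpha'
          (K * Num.sqrt ((m1 * m2 * k * d)%:R / n%:R)) C].
Proof.
pose beta := Num.min alpha alpha' / 5.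
have [beta0|beta_le0] := ltP 0 beta; last first.
  (* alpha and alpha' are positive as soon as some dimensions are admissible *)
  exists 1 => // m1 m2 n k0 k m d dalpha dalpha' _ _ k01 k0k km; exfalso.
  have d0 : 0 < d%:R :> R.
    rewrite ltr0n /d addn_gt0; apply/orP; left.
    by rewrite (leq_trans (leq_trans k01 (ltnW k0k)))// (leq_trans km)// geq_minl.
  move: beta_le0; rewrite leNgt => /negP; apply.
  rewrite divr_gt0// lt_min (lt_le_trans _ dalpha) ?divr_gt0//=.
  by rewrite (lt_le_trans _ dalpha')// mulr_gt0 ?expR_gt0.
have beta_alpha : beta *+ 5 <= alpha.
  by rewrite -mulr_natr /beta divfK// ge_min lexx.
have beta_alpha' : beta <= alpha'.
  have : beta *+ 5 <= alpha' by rewrite -mulr_natr /beta divfK// ge_min lexx orbT.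
  by move: beta0; lra.
pose Lam := noise_scale sigma U (2 * a).
have Lam0 : 0 < Lam := noise_scale_gt0 a_gt0 U_gt0 sigma_gt0.
pose lam := (4 * Lam)^-1.
have lam0 : 0 < lam by rewrite invr_gt0; exact: mulr_gt0.
pose tau := threshold Lam beta.
have c0 : 0 < lam / 2 by rewrite divr_gt0.
have [J J0 tail] := net_tail_sum (2 * lam * tau) c0 beta0.
exists (2 * J%:R); first by rewrite mulr_gt0 ?ltr0n.
move=> m1 m2 n k0 k m d _ _ nm mn k01 k0k km.
have k_gt0 : (0 < k)%N by apply: leq_trans (ltnW k0k).
have m10 : (0 < m1)%N by rewrite (leq_trans k_gt0)// (leq_trans km)// geq_minl.
have m20 : (0 < m2)%N by rewrite (leq_trans k_gt0)// (leq_trans km)// geq_minr.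
(* m >= 2, so that m log d > 0 *)
have n0 : (0 < n)%N.
  rewrite -(ltr0n R); apply: lt_le_trans mn; rewrite mulr_gt0//.
    by rewrite ltr0n (leq_trans k_gt0).
  by rewrite ln_gt0// ltr1n /d -(addn1 1) leq_add.
pose rate q : R := Num.sqrt ((m1 * m2 * q * d)%:R / n%:R).
have arg0 q : (0 < q)%N -> 0 < (m1 * m2 * q * d)%:R / n%:R :> R.
  by move=> q0; rewrite divr_gt0 ?ltr0n// !muln_gt0 m10 m20 q0 addn_gt0 m10.
have rate0 q : (0 < q)%N -> 0 < rate q by move=> q0; rewrite sqrtr_gt0 arg0.
have rate2 q : (0 < q)%N -> rate q ^+ 2 = (m1 * m2 * q * d)%:R / n%:R.
  by move=> q0; rewrite sqr_sqrtr// ltW// arg0.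
have rate_le : rate k0 <= rate k.
  rewrite ler_wsqrtr// ler_wpM2r ?invr_ge0 ?ler0n// ler_nat.
  by rewrite leq_mul// leq_mul// ltnW.
have [s0 [sep0 cl0 cov0]] := separated_net m10 m20 k01 a_gt0 (rate0 _ k01).
have [s1 [sep1 cl1 cov1]] := separated_net m10 m20 k_gt0 a_gt0 (rate0 _ k_gt0).
pose t q : R := tau * (q * d)%:R.
pose rho q : R := J%:R * rate q.
have rho0 : 0 <= rho k0 by rewrite mulr_ge0 ?ler0n// ltW// rate0.
have rho_le : rho k0 <= rho k by rewrite ler_wpM2l ?ler0n.
pose C := two_scale_set sigma (mx_class a k) s0 s1 (t k0) (t k) (rho k0 ^+ 2) (rho k ^+ 2).
have Cconf : confidence_set (mx_class a k) C by exact: confidence_set_two_scale.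
exists C; split => // disp Omega P B eps design noise.
pose obs M := observation B eps M.
have near := near_accepted a_gt0 U_gt0 sigma_gt0 beta0 m10 m20 n0 nm design noise.
have far q s (M : 'M[R]_(m1, m2)) : (0 < q)%N -> frob_separated (rate q) s ->
    (forall A, A \in s -> mx_class a q A) -> `|M| <= a ->
    (P [set w | exists2 A, A \in s & rho q ^+ 2 < frob2 (A - M) /\
      residual sigma A (obs M w) <= t q]%R <= (beta + beta)%:E)%E.
  move=> q0 seps cls Ma.
  rewrite /rho exprMn.
  apply: (far_rejected a_gt0 U_gt0 sigma_gt0 beta0 m10 m20 n0 nm design noise
     q0 (rate0 _ q0) (rate2 _ q0) _ Ma).
    by move=> A /cls[].
  by apply: (tail m1 m2 q (rate q) M s m10 m20 q0 (rate0 _ q0) seps) => A /cls[].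
have Cdiam x : (frobenius_diam (C x) <= (2 * J%:R * rate k)%:E)%E.
  by rewrite -mulrA; exact: frobenius_diam_two_scale.
split.
(* honesty: M0 is covered unless a far point of one of the nets is accepted
   (E0, E1) or the point of N_k near M0 is rejected (E2) *)
- move=> M0 [M0a M0k].
  have [As As1 Asnear] := cov1 _ (conj M0a M0k).
  pose E0 := [set w | exists2 A, A \in s0 & rho k0 ^+ 2 < frob2 (A - M0) /\
      residual sigma A (obs M0 w) <= t k0].
  pose E1 := [set w | exists2 A, A \in s1 & rho k ^+ 2 < frob2 (A - M0) /\
      residual sigma A (obs M0 w) <= t k].
  pose E2 := [set w | t k < residual sigma As (obs M0 w)].
  have mE0 : measurable E0 by exact: measurable_far_accepted.
  have mE1 : measurable E1 by exact: measurable_far_accepted.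
  have mE2 : measurable E2 by exact: measurable_residual_gt.
  have mG : measurable (obs M0 @^-1` [set x | C x M0]).
    by apply: measurable_observation; case: Cconf => _ + _; exact.
  have PE : (P (E0 `|` E1 `|` E2) <= alpha%:E)%E.
    apply: (@le_trans _ _ ((beta + beta) + (beta + beta) + beta)%:E); last first.
      by rewrite lee_fin; move: beta_alpha; rewrite -mulr_natr; lra.
    apply: (le_trans (measureU2 _ (measurableU _ _ mE0 mE1) mE2)).
    rewrite EFinD; apply: leeD.
      apply: (le_trans (measureU2 _ mE0 mE1)); rewrite [leRHS]EFinD; apply: leeD.
        exact: far.
      exact: far.
    apply: near => //; first by case: (cl1 _ As1).
    by rewrite -frob2N opprB -rate2.
  rewrite /data_law -[X in P X]setCK probability_setC; last exact: measurableC.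
  rewrite EFinB; apply: leeB => //; apply: le_trans PE.
  apply: le_measure; rewrite ?inE.
  + exact: measurableC.
  + by apply: measurableU => //; exact: measurableU.
  move=> w nC; apply: contrapT => nE; apply: nC; rewrite /= /C /two_scale_set.
  case acc0 : (accepted sigma (t k0) s0 (obs M0 w)) => [|A l].
    case acc1 : (accepted sigma (t k) s1 (obs M0 w)) => [|A l].
      apply: nE; right; rewrite /E2 /= ltNge; apply/negP => le.
      have : As \in accepted sigma (t k) s1 (obs M0 w) by rewrite mem_filter le.
      by rewrite acc1.
    have : A \in accepted sigma (t k) s1 (obs M0 w) by rewrite acc1 mem_head.
    rewrite mem_filter => /andP[le As'].
    split => //; rewrite leNgt; apply/negP => gt; apply: nE; left; right.
    by exists A.
  have : A \in accepted sigma (t k0) s0 (obs M0 w) by rewrite acc0 mem_head.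
  rewrite mem_filter => /andP[le As'].
  split => //; rewrite leNgt; apply/negP => gt; apply: nE; left; left.
  by exists A.
(* once the point of N_k0 near M0 is accepted, a ball of radius J r_k0 is
   selected *)
- apply: ge_ereal_sup => _ [M0 [M0a M0k] <-].
  have [As As0 Asnear] := cov0 _ (conj M0a M0k).
  apply: (@le_trans _ _ (P [set w | t k0 < residual sigma As (obs M0 w)])).
    apply: le_measure; rewrite ?inE.
    + by apply: measurable_observation; case: Cconf => _ _; exact.
    + exact: measurable_residual_gt.
    move=> w /=; rewrite /C /two_scale_set [in X in X -> _]ltNge => /negP diam.
    rewrite ltNge; apply/negP => le; apply: diam.
    have : As \in accepted sigma (t k0) s0 (obs M0 w) by rewrite mem_filter le.
    rewrite -/(obs M0 w); case: (accepted _ _ _ _) => // A l _.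
    by rewrite -mulrA; exact: frobenius_diam_ball.
  apply: (@le_trans _ _ beta%:E); last by rewrite lee_fin.
  by apply: near => //; [case: (cl0 _ As0)|rewrite -frob2N opprB -rate2].
- apply: ge_ereal_sup => _ [M0 _ <-].
  rewrite /data_law (_ : _ @^-1` _ = set0).
    by rewrite measure0 lee_fin (le_trans (ltW beta0)).
  apply/seteqP; split => w //=; rewrite ltNge => /negP; apply; exact: Cdiam.
Qed.
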